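(* Let $X_{n,j}$, $j=1,\dots,k_n$, be an array of martingale differences with respect to increasing filtrations $(\mathcal{F}_j^n)_{j\ge 0}$, $n=1,2,\dots$, such that: (i) $\max_{1\le i\le k_n}|X_{n,i}|\to 0$ in probability; (ii) there is an $L<\infty$ such that $E\max_{1\le j\le k_n}X_{n,j}^2\le L$ for all $n$; (iii) there exist $1\le\ell(n)\le k_n$ and $\mathcal{F}_{\ell(n)}^n$-measurable random variables $\eta_n^2$ such that $\sum_{j=1}^{k_n}X_{n,j}^2-\eta_n^2\to 0$ in probability; (iv) there exists a random variable $\eta^2$ such that $\eta_n^2\to\eta^2$ in distribution; and such that (vi) the random variables $\eta_n^2$ are $\mathcal{F}_0^n$-measurable, or (vii) the sequences $(X_{n,j})_j$ are strictly stationary and the $\eta_n^2$ are measurable with respect to the $\sigma$-algebras of invariant sets. Then the sums $\sum_{j=1}^{k_n}X_{n,j}$ converge in distribution, as $n\to\infty$, to a law with characteristic function $t\mapsto E\exp(-\eta^2t^2/2)$.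
   Context: All limits are for $n\to\infty$. Martingale differences with respect to $(\mathcal{F}_j^n)_{j\ge0}$ means: $X_{n,j}$ is integrable, $\mathcal{F}_j^n$-measurable and $E(X_{n,j}\mid\mathcal{F}_{j-1}^n)=0$. In (vii), for each $n$ the strictly stationary sequence $(X_{n,j})_j$ is represented by a measure preserving transformation $T_{(n)}$ of the underlying probability space with $X_{n,j}=X_{n,0}\circ T_{(n)}^j$ for all $j$; the $\sigma$-algebra of invariant sets is the $\sigma$-algebra of measurable sets $A$ with $T_{(n)}^{-1}A=A$, and $\eta_n^2$ is measurable with respect to it.
   Formalization: In case (vii) the X_{n,j} are required to be martingale differences for all j ≥ 1, not only for j ≤ k_n; without this the claim fails, e.g. when ℓ(n) = k_n. *)

(* Defs.v *)
From HB Require Import structures.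
From mathcomp Require Import all_boot all_order all_algebra.
From mathcomp Require Import all_classical all_reals all_analysis.
From mathcomp Require Export complex.

Set Implicit Arguments.
Unset Strict Implicit.
Unset Printing Implicit Defensive.

Import Order.TTheory GRing.Theory Num.Theory.
Import numFieldNormedType.Exports.

Local Open Scope classical_set_scope.
Local Open Scope ring_scope.

Section Conditioning.
Context d (T : measurableType d) (R : realType) (P : probability T R).

Definition sub_sigma_algebra (G : set (set T)) : Prop :=
  sigma_algebra setT G /\ G `<=` measurable.

Definition measurable_wrt (G : set (set T)) (f : T -> R) : Prop :=
  forall B : set R, measurable B -> G (f @^-1` B).

Definition filtration (F : nat -> set (set T)) : Prop :=
  (forall j, sub_sigma_algebra (F j)) /\
  (forall i j, (i <= j)%N -> F i `<=` F j).

(* [Y] is a version of [E(X | G)]. *)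
Definition is_cond_expectation (G : set (set T)) (X Y : T -> R) : Prop :=
  [/\ measurable_wrt G Y,
      P.-integrable setT (EFin \o Y) &
      forall A, G A -> \int[P]_(w in A) Y w = \int[P]_(w in A) X w].

(* To be used with [0 < j] only, as [F j.-1] stands for F_{j-1}. *)
Definition martingale_difference (F : nat -> set (set T)) (X : nat -> T -> R)
    (j : nat) : Prop :=
  [/\ P.-integrable setT (EFin \o X j),
      measurable_wrt (F j) (X j) &
      is_cond_expectation (F j.-1) (X j) (cst 0)].

Definition measure_preserving (f : T -> T) : Prop :=
  measurable_fun setT f /\
  forall A, measurable A -> P (f @^-1` A) = P A.

Definition invariant_sets (f : T -> T) : set (set T) :=
  [set A | measurable A /\ f @^-1` A = A].

End Conditioning.

Section Convergence.
Context (R : realType).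

Definition cvg0_in_probability (d : nat -> measure_display)
    (T : forall n, measurableType (d n)) (P : forall n, probability (T n) R)
    (Y : forall n, T n -> R) : Prop :=
  forall e : R, 0 < e ->
    (fun n => P n [set w | e <= `|Y n w|]) @ \oo --> 0%E.

(* Weak convergence of the laws of the [Y n] to [mu]; the [Y n] are meant to be
   measurable. *)
Definition cvg_in_distribution (d : nat -> measure_display)
    (T : forall n, measurableType (d n)) (P : forall n, probability (T n) R)
    (Y : forall n, T n -> R) (mu : probability R R) : Prop :=
  forall f : R -> R, continuous f -> bounded_fun f ->
    (fun n => \int[P n]_w f (Y n w)) @ \oo --> \int[mu]_x f x.

(* The integral of x |-> exp(i t x), written as its real and imaginary parts. *)
Definition charfun (mu : probability R R) (t : R) : R[i] :=
  Complex (\int[mu]_x cos (t * x)) (\int[mu]_x sin (t * x)).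

End Convergence.

(* Main.v *)
(* McLeish's argument.  Write T_n(t) = prod_j (1 + i t Z_j), where Z_j is X_j
   stopped once the quadratic variation exceeds a level.  For random variables
   G measurable for F_0, the martingale property gives E[T_n G] = E[G], with
   G = exp(-t^2 eta_n^2/2) in particular; and
   T_n exp(-t^2 sum_j Z_j^2 / 2) is pathwise close to exp(i t sum_j Z_j), because
   (1 + ix) exp(-x^2/2) = exp(ix) + O(|x|^3) and both sides have modulus at
   most 1.  This yields convergence of the characteristic functions to
   E exp(-eta^2 t^2/2), which is that of eta N for a standard normal N
   independent of eta.  Since the stopped sums are bounded in L^2, the laws of the
   sums are tight, and weak convergence follows by approximating a test function on
   [-M, M] by a polynomial in sin(x/2M), which stays bounded outside.

   Under (vii), invariance of eta_n^2 under the transformation shows that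
   ((X_j)_{j <= k}, eta_n^2) has the same law as ((X_{l+j})_{j <= k}, eta_n^2);
   the latter array has eta_n^2 measurable for its initial sigma-algebra F_l,
   which is case (vi). *)
Require Import Defs.
From HB Require Import structures.
From mathcomp Require Import all_boot all_order all_algebra.
From mathcomp Require Import all_classical all_reals all_analysis.
From mathcomp Require Import complex.
From mathcomp Require Import measurable_realfun ring lra zify.

Set Implicit Arguments.
Unset Strict Implicit.
Unset Printing Implicit Defensive.

Import Order.TTheory GRing.Theory Num.Theory.
Import numFieldNormedType.Exports.

Local Open Scope classical_set_scope.
Local Open Scope ring_scope.

(** * Elementary estimates and McLeish's product *)

(** The obstacle is the size of [T_n]. Unstopped, its modulus is controlled only by
    [expR (t^2 * sum_j X_j^2 / 2)], and the quadratic variation need not be bounded. The stopping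
    rule looks at the squares strictly before the current one, which keeps it predictable; the price
    is an overshoot by one term, so that [|T_n|^2] is at most a constant times
    [1 + t^2 * max_j X_j^2]. Hypothesis (ii) bounds the expectation of this quantity. The factor [G]
    is truncated to 0 where [eta_n^2 > K], while stopping takes place at level [K + 1]. Hence,
    wherever [G] survives and (i) and (iii) hold up to some [r <= 1], stopping never acts and the
    pathwise comparison concerns the original sums. On the remaining event, of small probability,
    Young's inequality with a parameter [a] converts the L^2 bound on [T_n] into a small
    contribution. The choices are made in the order [K], then [a] and [r], then [n]. *)

Section TrigonometricBounds.
Variable R : realType.
Implicit Types x t : R.

(** Engine of a bootstrap: in each of the four Taylor bounds below, the derivative of the difference
    of the two sides is the difference treated just before, starting from [1 - cos y >= 0]. *)
Lemma ge0_of_derive_ge0 (f df : R -> R) :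
  (forall x, is_derive x 1 f (df x)) -> (forall x, 0 <= x -> 0 <= df x) ->
  f 0 = 0 -> forall x, 0 <= x -> 0 <= f x.
Proof.
move=> fdf df0 f0 x; rewrite le_eqVlt => /predU1P[<-|x0]; first by rewrite f0.
have cf : {within `[0, x], continuous f}.
  by apply: derivable_within_continuous => y _; case: (fdf y).
have [c /[!in_itv]/= /andP[c0 _]] := MVT x0 (fun y _ => fdf y) cf.
by rewrite f0 !subr0 => ->; rewrite mulr_ge0// ?df0// ltW.
Qed.

Lemma sin_lex x : 0 <= x -> sin x <= x.
Proof.
move=> x0; rewrite -subr_ge0.
apply: (@ge0_of_derive_ge0 (fun y => y - sin y) (fun y => 1 - cos y)) => //.
by rewrite sin0 subr0.
Qed.

Lemma cos_ge1Bsqr x : 0 <= x -> 1 - x ^+ 2 / 2 <= cos x.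
Proof.
move=> x0; rewrite -subr_ge0.
apply: (@ge0_of_derive_ge0 (fun y => cos y - (1 - y ^+ 2 / 2))
   (fun y => y - sin y)) => //.
- move=> y; apply: is_derive_eq.
  by rewrite /GRing.scale/=; field.
- by move=> y y0; rewrite subr_ge0 sin_lex.
- by rewrite cos0 expr0n/= mul0r subr0 subrr.
Qed.

Lemma sin_gexBcube x : 0 <= x -> x - x ^+ 3 / 6 <= sin x.
Proof.
move=> x0; rewrite -subr_ge0.
apply: (@ge0_of_derive_ge0 (fun y => sin y - (y - y ^+ 3 / 6))
   (fun y => cos y - (1 - y ^+ 2 / 2))) => //.
- move=> y; apply: is_derive_eq.
  by rewrite /GRing.scale/=; field.
- by move=> y y0; rewrite subr_ge0 cos_ge1Bsqr.
- by rewrite sin0 expr0n/= mul0r subr0 subrr.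
Qed.

Lemma cos_le1BsqrD x : 0 <= x -> cos x <= 1 - x ^+ 2 / 2 + x ^+ 4 / 24.
Proof.
move=> x0; rewrite -subr_ge0.
apply: (@ge0_of_derive_ge0 (fun y => (1 - y ^+ 2 / 2 + y ^+ 4 / 24) - cos y)
   (fun y => sin y - (y - y ^+ 3 / 6))) => //.
- move=> y; apply: is_derive_eq.
  by rewrite /GRing.scale/=; field.
- by move=> y y0; rewrite subr_ge0 sin_gexBcube.
- by rewrite cos0 !expr0n/= !mul0r subr0 addr0 subrr.
Qed.

End TrigonometricBounds.

Section McLeishProduct.
Variable R : realType.
Local Open Scope complex_scope.

(** Telescoping: the factors are exchanged one at a time, and the others, of modulus at most 1, do
    not amplify the error. *)
Lemma ler_norm_prodB (C : numDomainType) n (a b : 'I_n -> C) :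
  (forall j, `|a j| <= 1) -> (forall j, `|b j| <= 1) ->
  `|\prod_j a j - \prod_j b j| <= \sum_j `|a j - b j|.
Proof.
elim: n a b => [|n IH] a b a1 b1; first by rewrite !big_ord0 subrr normr0.
rewrite !big_ord_recr/=.
set A := \prod_(i < n) _; set B := \prod_(i < n) _.
rewrite (_ : _ - _ = (A - B) * a ord_max + B * (a ord_max - b ord_max)); last by ring.
rewrite (le_trans (ler_normD _ _))// lerD//.
- rewrite normrM (le_trans (ler_piMr _ (a1 _)))//.
  exact: IH.
- rewrite normrM ler_piMl// normr_prod.
  by apply: prodr_ile1 => i _; rewrite normr_ge0 b1.
Qed.

Lemma normc_le_sum (z : R[i]) : `|z| <= (`|complex.Re z| + `|complex.Im z|)%:C.
Proof.
rewrite normc_def lecR -[leRHS]ger0_norm ?addr_ge0// -sqrtr_sqr ler_wsqrtr//.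
by rewrite sqrrD !real_normK ?num_real// lerD2r lerDl mulrn_wge0 ?mulr_ge0.
Qed.

Lemma normc_ge_Im (z : R[i]) : `|complex.Im z|%:C <= `|z|.
Proof. by rewrite normc_def lecR -sqrtr_sqr ler_wsqrtr// lerDr sqr_ge0. Qed.

Definition cis (x : R) : R[i] := cos x +i* sin x.

Lemma norm_cis x : `|cis x| = 1.
Proof. by rewrite normc_def/= cos2Dsin2 sqrtr1. Qed.

Lemma prod_cis n (x : nat -> R) : \prod_(j < n) cis (x j) = cis (\sum_(j < n) x j).
Proof.
elim: n => [|n IH]; first by rewrite !big_ord0 /cis cos0 sin0.
rewrite !big_ord_recr/= IH /cis; simpc.
by rewrite cosD sinD [cos _ * sin _ + _]addrC.
Qed.

(** Everything comes from [1 + y <= expR y]: at [y = -u] it fixes the sign, and at [y = u],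
    inverted, it gives [expR (-u) <= 1/(1+u) <= 1 - u + u^2]. *)
Lemma ler_expRN (u : R) : 0 <= u -> `|expR (- u) - 1 + u| <= u ^+ 2.
Proof.
move=> u0; have h := expR_ge1Dx (- u); have h' := expR_ge1Dx u.
rewrite ger0_norm; last lra.
have u1 : 0 < 1 + u by lra.
have : expR (- u) <= (1 + u)^-1 by rewrite expRN lef_pV2// posrE// expR_gt0.
move=> /le_trans-/(_ (1 - u + u ^+ 2)) H.
suff : expR (- u) <= 1 - u + u ^+ 2 by lra.
apply: H; rewrite -[leLHS]mul1r ler_pdivrMr//.
have : 0 <= u ^+ 3 by rewrite exprn_ge0.
nra.
Qed.

(** The real parts share the expansion [1 - x^2/2] up to order 4, the imaginary parts share [x] up
    to order 3. The errors add up to at most [29/24 * |x|^3], rounded up to 2. *)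
Lemma mcleish_factor_near (x : R) : `|x| <= 1 ->
  `|(1 +i* x) * (expR (- (x ^+ 2) / 2))%:C - cis x| <= (2 * `|x| ^+ 3)%:C.
Proof.
move=> x1; apply: le_trans (normc_le_sum _) _; rewrite lecR /=.
simpc => /=.
wlog x0 : x x1 / 0 <= x => [hw|].
  have [/hw|/ltW xn] := leP 0 x; first exact.
  have := hw (- x); rewrite !normrN sqrrN cosN sinN oppr_ge0.
  have -> : - x * expR (- (x ^+ 2 / 2)) - - sin x =
    - (x * expR (- (x ^+ 2 / 2)) - sin x) by ring.
  by rewrite normrN; apply.
rewrite (ger0_norm x0) in x1 *.
have := @ler_expRN (x ^+ 2 / 2).
set E := expR _; move=> /(_ (divr_ge0 (sqr_ge0 _) (ler0n _ _))) hE.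
have := sin_lex x0; have := sin_gexBcube x0.
have := cos_ge1Bsqr x0; have := cos_le1BsqrD x0.
move=> c2 c1 s1 s2.
have x3 : 0 <= x ^+ 3 by rewrite exprn_ge0.
have x4 : x ^+ 4 <= x ^+ 3 by rewrite [leLHS]exprS ler_piMl.
have x5 : x * x ^+ 4 <= x ^+ 3 by rewrite (le_trans _ x4)// ler_piMl// exprn_ge0.
have x40 : 0 <= x ^+ 4 by rewrite exprn_ge0.
have hE' : x * `|E - 1 + x ^+ 2 / 2| <= x * (x ^+ 2 / 2) ^+ 2 by rewrite ler_wpM2l.
rewrite -[x in x * `|_|](ger0_norm x0) -normrM in hE'.
have h4 : (x ^+ 2 / 2) ^+ 2 = x ^+ 4 / 4 by field.
have h5 : x * (E - 1 + x ^+ 2 / 2) = x * E - x + x ^+ 3 / 2 by field.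
rewrite h4 in hE; rewrite h4 h5 in hE'.
move: hE hE'; rewrite !ler_norml => /andP[e1 e2] /andP[e3 e4].
have H1 : `|E - cos x| <= x ^+ 4 / 4 + x ^+ 4 / 24 by rewrite ler_norml; lra.
have H2 : `|x * E - sin x| <= x ^+ 3 / 2 + x * x ^+ 4 / 4 + x ^+ 3 / 6.
  by rewrite ler_norml; lra.
lra.
Qed.

(** The squared modulus is [(1 + x^2) * expR (- x^2)], and [1 + y <= expR y]. *)
Lemma norm_mcleish_factor (x : R) :
  `|(1 +i* x) * (expR (- (x ^+ 2) / 2))%:C| <= 1.
Proof.
rewrite normrM [X in _ * X]normc_def normc_def/= expr0n/= addr0 expr1n sqrtr_sqr.
rewrite ger0_norm ?expR_ge0// -rmorphM/= (_ : 1 = 1%:C)// lecR.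
have xE : expR (- x ^+ 2 / 2) = Num.sqrt (expR (- x ^+ 2)).
  have -> : expR (- x ^+ 2) = expR (- x ^+ 2 / 2) ^+ 2.
    by rewrite -expRM_natl; congr expR; field.
  by rewrite sqrtr_sqr ger0_norm ?expR_ge0.
rewrite xE -sqrtrM ?addr_ge0 ?sqr_ge0// -[leRHS]sqrtr1 ler_wsqrtr//.
by rewrite expRN ler_pdivrMr ?expR_gt0// mul1r expR_ge1Dx.
Qed.

Definition mcleish (n : nat) (x : nat -> R) : R[i] := \prod_(j < n) (1 +i* x j).

Lemma norm_mcleish n x :
  complex.Re (mcleish n x) ^+ 2 + complex.Im (mcleish n x) ^+ 2 =
  \prod_(j < n) (1 + x j ^+ 2).
Proof.
rewrite /mcleish; elim: n => [|n IH].
  by rewrite !big_ord0 /= expr1n expr0n addr0.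
rewrite !big_ord_recr /= -IH; case: (\prod_(_ < n) _) => a b /=; ring.
Qed.

(** The cubic errors are bounded by [r * x_j^2], so that a small maximum together with a bounded sum
    of squares makes the total error small. *)
Lemma mcleish_approx n (x : nat -> R) (r : R) : r <= 1 ->
  (forall j, (j < n)%N -> `|x j| <= r) ->
  `|mcleish n x * (expR (- (\sum_(j < n) x j ^+ 2) / 2))%:C
     - cis (\sum_(j < n) x j)| <= (2 * r * \sum_(j < n) x j ^+ 2)%:C.
Proof.
move=> r1 xr.
have -> : (expR (- (\sum_(j < n) x j ^+ 2) / 2))%:C =
    \prod_(j < n) (expR (- x j ^+ 2 / 2))%:C :> R[i].
  rewrite -rmorph_prod/= -expR_sum; congr (expR _)%:C.
  by rewrite -sumrN mulr_suml.
rewrite -big_split/= -prod_cis.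
apply: le_trans (@ler_norm_prodB _ _ _ _ _ _) _ => //=.
- by move=> j; exact: norm_mcleish_factor.
- by move=> j; rewrite norm_cis.
rewrite mulr_sumr rmorph_sum/=; apply: ler_sum => j _.
have xj := xr j (ltn_ord j).
apply: le_trans (mcleish_factor_near _) _; first exact: le_trans xj r1.
rewrite lecR -mulrA ler_pM2l// exprS real_normK ?num_real//.
by rewrite ler_wpM2r ?sqr_ge0.
Qed.

End McLeishProduct.

(** * Characteristic functions and weak convergence *)

Section IntegrableEFin.
Context d (T : measurableType d) (R : realType) (mu : {measure set T -> \bar R}).
Implicit Types f g : T -> R.

Lemma integrable_EFinD f g : mu.-integrable setT (EFin \o f) ->
  mu.-integrable setT (EFin \o g) ->
  mu.-integrable setT (EFin \o (fun w => f w + g w)).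
Proof. by move=> fi gi; exact: (integrableD measurableT fi gi). Qed.

Lemma integrable_EFinB f g : mu.-integrable setT (EFin \o f) ->
  mu.-integrable setT (EFin \o g) ->
  mu.-integrable setT (EFin \o (fun w => f w - g w)).
Proof. by move=> fi gi; exact: (integrableB measurableT fi gi). Qed.

Lemma integrable_EFinZ f c : mu.-integrable setT (EFin \o f) ->
  mu.-integrable setT (EFin \o (fun w => c * f w)).
Proof. by move=> fi; exact: (integrableZl measurableT c fi). Qed.

End IntegrableEFin.

Section BoundedRandomVariables.
Context d (T : measurableType d) (R : realType) (P : probability T R).
Implicit Types f g : T -> R.

Lemma bounded_integrable f (B : R) : measurable_fun setT f ->
  (forall w, `|f w| <= B) -> P.-integrable setT (EFin \o f).
Proof.
move=> mf fB; apply: measurable_bounded_integrable => //.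
  by rewrite (le_lt_trans (probability_le1 _ _))// ltry.
exists B; split; first by rewrite num_real.
by move=> M BM w _; apply: (le_trans (fB w)); exact: ltW.
Qed.

Lemma Rintegral_prob_cst (r : R) : \int[P]_w r = r.
Proof. by rewrite Rintegral_cst// [X in fine X](_ : _ = 1%E) ?mulr1//; exact: probability_setT.
Qed.

Lemma Rintegral_indic E : measurable E -> \int[P]_w \1_E w = fine (P E).
Proof. by move=> mE; rewrite /Rintegral integral_indic// setIT. Qed.

Lemma ler_dist_Rintegral f g E (e C : R) :
  P.-integrable setT (EFin \o f) -> P.-integrable setT (EFin \o g) ->
  measurable E -> (forall w, ~ E w -> `|f w - g w| <= e) ->
  (forall w, E w -> `|f w - g w| <= e + C) ->
  `|\int[P]_w f w - \int[P]_w g w| <= e + C * fine (P E).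
Proof.
move=> fi gi mE fgE fgC.
have fgi := integrable_EFinB fi gi.
rewrite -RintegralB//; apply: le_trans (le_normr_Rintegral measurableT fgi) _.
have Ei : P.-integrable setT (EFin \o (\1_E : T -> R)) by exact: integrable_indic.
have CE := integrable_EFinZ C Ei.
have ei : P.-integrable setT (EFin \o (fun _ : T => e)).
  by apply: (@bounded_integrable _ `|e|) => //; exact: measurable_cst.
rewrite -(Rintegral_indic mE) -RintegralZl//.
rewrite -[X in _ <= X + _]Rintegral_prob_cst -RintegralD//.
apply: le_Rintegral => //; [exact: (integrable_norm fgi)|exact: integrable_EFinD|].
move=> w _; rewrite indicE; case: (boolP (w \in E)) => [/set_mem/fgC|/negP wE].
  by rewrite mulr1.
by rewrite mulr0 addr0 fgE// => /mem_set.
Qed.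

Lemma measurable_norm_gt f M : measurable_fun setT f ->
  measurable [set w | M < `|f w|].
Proof.
move=> mf; have mnf : measurable_fun setT (fun w => `|f w|).
  exact: measurableT_comp.
rewrite -[X in measurable X]setTI.
by apply: (measurable_fun_ltr (measurable_cst M) mnf measurableT (Y := [set true])).
Qed.

Lemma measurable_norm_ge f M : measurable_fun setT f ->
  measurable [set w | M <= `|f w|].
Proof.
move=> mf; have mnf : measurable_fun setT (fun w => `|f w|).
  exact: measurableT_comp.
rewrite -[X in measurable X]setTI.
by apply: (measurable_fun_ler (measurable_cst M) mnf measurableT (Y := [set true])).
Qed.

Lemma measurable_bigmax (f : nat -> T -> R) (a b : nat) :
  (forall j, measurable_fun setT (f j)) ->
  measurable_fun setT (fun w => \big[Num.max/0]_(a <= j < b) f j w).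
Proof.
move=> mf; elim: (index_iota a b) => [|i s IH].
  by under eq_fun do rewrite big_nil; exact: measurable_cst.
by under eq_fun do rewrite big_cons; exact: measurable_maxr.
Qed.

End BoundedRandomVariables.

(** * Approximation by trigonometric polynomials *)

Section TrigonometricPolynomials.
Variable R : realType.

(** The constructors are linear, so that convergence of the integrals of cosines and sines passes to
    the whole class by induction. Stability under products is recovered from the product-to-sum
    formulas in [trig_polyM]. *)
Inductive trig_poly : (R -> R) -> Prop :=
| trig_poly_cos t : trig_poly (fun x => cos (t * x))
| trig_poly_sin t : trig_poly (fun x => sin (t * x))
| trig_polyD f g : trig_poly f -> trig_poly g -> trig_poly (fun x => f x + g x)
| trig_polyZ c f : trig_poly f -> trig_poly (fun x => c * f x).

Lemma trig_poly_ext f g : f =1 g -> trig_poly f -> trig_poly g.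
Proof. by move=> /funext ->. Qed.

Lemma trig_poly_cst c : trig_poly (fun=> c).
Proof.
apply: trig_poly_ext (trig_polyZ c (trig_poly_cos 0)) => x.
by rewrite mul0r cos0 mulr1.
Qed.

Lemma trig_polyM f g : trig_poly f -> trig_poly g -> trig_poly (fun x => f x * g x).
Proof.
move=> hf hg; elim: hf => {f} [t|t|f1 f2 _ h1 _ h2|c f _ h]; last first.
- by apply: trig_poly_ext (trig_polyZ c h) => x; rewrite mulrA.
- by apply: trig_poly_ext (trig_polyD h1 h2) => x; rewrite mulrDl.
- elim: hg => {g} [s|s|g1 g2 _ h1 _ h2|c g _ h].
  + apply: (trig_poly_ext _ (trig_polyZ 2^-1 (trig_polyD (trig_poly_sin (t + s))
      (trig_poly_sin (t - s))))) => x.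
    by rewrite (mulrDl t s x) (mulrBl x t s) sinB sinD; field.
  + apply: (trig_poly_ext _ (trig_polyZ 2^-1 (trig_polyD (trig_poly_cos (t - s))
      (trig_polyZ (-1) (trig_poly_cos (t + s)))))) => x.
    by rewrite (mulrDl t s x) (mulrBl x t s) cosB cosD; field.
  + by apply: trig_poly_ext (trig_polyD h1 h2) => x; rewrite mulrDr.
  + by apply: trig_poly_ext (trig_polyZ c h) => x; rewrite mulrCA.
- elim: hg => {g} [s|s|g1 g2 _ h1 _ h2|c g _ h].
  + apply: (trig_poly_ext _ (trig_polyZ 2^-1 (trig_polyD (trig_poly_cos (t - s))
      (trig_poly_cos (t + s))))) => x.
    by rewrite (mulrDl t s x) (mulrBl x t s) cosB cosD; field.
  + apply: (trig_poly_ext _ (trig_polyZ 2^-1 (trig_polyD (trig_poly_sin (t + s))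
      (trig_polyZ (-1) (trig_poly_sin (t - s)))))) => x.
    by rewrite (mulrDl t s x) (mulrBl x t s) sinB sinD; field.
  + by apply: trig_poly_ext (trig_polyD h1 h2) => x; rewrite mulrDr.
  + by apply: trig_poly_ext (trig_polyZ c h) => x; rewrite mulrCA.
Qed.

Lemma trig_poly_bounded f : trig_poly f -> exists B, forall x, `|f x| <= B.
Proof.
elim=> {f} [t|t|f g _ [B fB] _ [C gC]|c f _ [B fB]].
- by exists 1 => x; exact: cos_max.
- by exists 1 => x; exact: sin_max.
- by exists (B + C) => x; rewrite (le_trans (ler_normD _ _))// lerD.
- by exists (`|c| * B) => x; rewrite normrM ler_wpM2l.
Qed.

Lemma trig_poly_measurable f : trig_poly f -> measurable_fun setT f.
Proof.
elim=> {f} [t|t|f g _ mf _ mg|c f _ mf].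
- apply: measurableT_comp; first by apply: continuous_measurable_fun; exact: continuous_cos.
  exact: measurable_funM.
- apply: measurableT_comp; first by apply: continuous_measurable_fun; exact: continuous_sin.
  exact: measurable_funM.
- exact: measurable_funD.
- exact: measurable_funM.
Qed.

End TrigonometricPolynomials.

Section Bernstein.
Variable R : realType.

(* The Bernstein polynomial of [h], as the expectation of [h] at a binomial
   random variable, computed one Bernoulli trial at a time. *)
Fixpoint bernstein (n : nat) (h : nat -> R) (u : R) : R :=
  if n is m.+1 then (1 - u) * bernstein m h u + u * bernstein m (h \o S) u
  else h 0%N.

Lemma bernstein_trig n h (u : R -> R) : trig_poly u ->
  trig_poly (fun x => bernstein n h (u x)).
Proof.
move=> tu; elim: n h => [|n IH] h /=; first exact: trig_poly_cst.
apply: trig_polyD; apply: trig_polyM => //.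
apply: trig_poly_ext (trig_polyD (trig_poly_cst 1) (trig_polyZ (-1) tu)) => x.
by rewrite mulN1r.
Qed.

Lemma bernstein_cstD n h c u :
  bernstein n (fun k => h k + c) u = bernstein n h u + c.
Proof.
by elim: n h => [//|n IH] h /=; rewrite IH (IH (h \o S)); ring.
Qed.

Lemma bernsteinZ n h c u : bernstein n (fun k => c * h k) u = c * bernstein n h u.
Proof.
by elim: n h => [//|n IH] h /=; rewrite IH (IH (h \o S)); ring.
Qed.

Lemma bernsteinN n h u : bernstein n (fun k => - h k) u = - bernstein n h u.
Proof.
by elim: n h => [//|n IH] h /=; rewrite IH (IH (h \o S)); ring.
Qed.

Lemma le_bernstein n h1 h2 u : 0 <= u <= 1 ->
  (forall k, (k <= n)%N -> h1 k <= h2 k) -> bernstein n h1 u <= bernstein n h2 u.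
Proof.
move=> /andP[u0 u1]; elim: n h1 h2 => [|n IH] h1 h2 h12 /=; first exact: h12.
apply: lerD; apply: ler_wpM2l => //; first by rewrite subr_ge0.
- by apply: IH => k kn; apply: h12; rewrite leqW.
- by apply: IH => k kn; exact: h12.
Qed.

(** Variance plus squared bias of a binomial variable. At [c = n u] only the variance remains, as a
    Chebyshev argument requires. *)
Lemma bernstein_sqr n u c :
  bernstein n (fun k => (k%:R - c) ^+ 2) u = n%:R * u * (1 - u) + (n%:R * u - c) ^+ 2.
Proof.
elim: n c => [|n IH] c /=; first by ring.
rewrite IH (_ : _ \o _ = fun k => (k%:R - (c - 1)) ^+ 2); last first.
  by apply/funext => k /=; rewrite -natr1; ring.
by rewrite IH -natr1; ring.
Qed.

Lemma bernstein_norm n h u B : 0 <= u <= 1 -> (forall k, `|h k| <= B) ->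
  `|bernstein n h u| <= B.
Proof.
move=> u01 hB; have bB : bernstein n (fun=> B) u = B.
  by elim: n => [//|n /= IH]; rewrite (_ : _ \o _ = fun=> B)// IH; ring.
rewrite ler_norml; apply/andP; split.
  rewrite lerNl -bernsteinN -[leRHS]bB; apply: le_bernstein => // k _.
  by have /ler_normlP[] := hB k.
rewrite -[leRHS]bB; apply: le_bernstein => // k _.
by have /ler_normlP[] := hB k.
Qed.

Lemma bernstein_approx n (g : R -> R) u B e r : (0 < n)%N ->
  0 <= u <= 1 -> 0 < r -> (forall v, `|g v| <= B) ->
  (forall v, 0 <= v <= 1 -> `|v - u| < r -> `|g v - g u| <= e) ->
  `|bernstein n (fun k => g (k%:R / n%:R)) u - g u| <=
    e + 2 * B / (r ^+ 2 * n%:R).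
Proof.
move=> n0 u01 r0 gB ge.
have e0 : 0 <= e by apply: le_trans (ge u u01 _); rewrite ?normr_ge0 ?subrr ?normr0.
have B0 : 0 <= B by apply: le_trans (gB u).
have nR : 0 < n%:R :> R by rewrite ltr0n.
(* Chebyshev majorant: the quadratic term is [2 * B * ((k/n - u) / r)^2], at least [2 * B] once
   [k/n] is at distance [r] from [u]; closer than that, [e] suffices. *)
pose h k : R := 2 * B / (r ^+ 2 * n%:R ^+ 2) * (k%:R - n%:R * u) ^+ 2 + e.
have hE : bernstein n h u <= e + 2 * B / (r ^+ 2 * n%:R).
  rewrite /h bernstein_cstD bernsteinZ bernstein_sqr subrr expr0n/= addr0 addrC lerD2l.
  have /andP[u0 u1] := u01.
  have -> : 2 * B / (r ^+ 2 * n%:R ^+ 2) * (n%:R * u * (1 - u)) =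
     2 * B / (r ^+ 2 * n%:R) * (u * (1 - u)).
    by field; rewrite ?gt_eqF//.
  apply: ler_piMr; last nra.
  by rewrite divr_ge0 ?mulr_ge0 ?exprn_ge0// ltW.
have gh k : (k <= n)%N -> `|g (k%:R / n%:R) - g u| <= h k.
  move=> kn; have [kr|kr] := ltP `|k%:R / n%:R - u| r.
    rewrite /h (le_trans (ge _ _ kr))//.
      by rewrite divr_ge0//= ler_pdivrMr// mul1r ler_nat.
    by rewrite lerDr mulr_ge0 ?sqr_ge0// divr_ge0 ?mulr_ge0 ?exprn_ge0// ltW.
  apply: (@le_trans _ _ (2 * B)).
    by rewrite (le_trans (ler_normB _ _))// mulr2n mulrDl !mul1r lerD.
  rewrite /h -[leLHS]addr0 lerD//.
  have -> : k%:R - n%:R * u = n%:R * (k%:R / n%:R - u) by field; rewrite gt_eqF.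
  rewrite exprMn.
  have -> : forall z, 2 * B / (r ^+ 2 * n%:R ^+ 2) * (n%:R ^+ 2 * z) = 2 * B * (z / r ^+ 2).
    by move=> z; field; rewrite !gt_eqF.
  rewrite ler_peMr ?mulr_ge0// ler_pdivlMr ?exprn_gt0// mul1r.
  by rewrite -[leRHS]real_normK ?num_real// lerXn2r ?nnegrE// ltW.
rewrite -bernstein_cstD; apply: le_trans hE.
rewrite ler_norml; apply/andP; split.
  rewrite lerNl -bernsteinN; apply: le_bernstein => // k kn.
  by have /ler_normlP[] := gh k kn.
apply: le_bernstein => // k kn.
by have /ler_normlP[] := gh k kn.
Qed.

End Bernstein.

Section TrigonometricApproximation.
Variable R : realType.

Lemma unif_continuous_itv (g : R -> R) a b e : continuous g -> 0 < e ->
  exists2 r, 0 < r & forall u v, a <= u <= b -> `|v - u| < r -> `|g v - g u| < e.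
Proof.
move=> cg e0.
have /compact_near_coveringP ab := @segment_compact R a b.
have : \forall r \near 0^'+, `[a, b] `<=`
    (fun u => forall v, `|v - u| < r -> `|g v - g u| < e).
  apply: ab.
  move=> u _; have e2 : 0 < e / 2 by rewrite divr_gt0.
  have /cvgrPdist_lt/(_ _ e2)/nbhs_ballP[r /= r0 rg] := cg u.
  exists ([set x | ball u (r / 2) x], [set s | s < r / 2]).
    split; first by apply: nbhsx_ballx; rewrite divr_gt0.
    by apply: nbhs_right_lt; rewrite divr_gt0.
  move=> [x s] [/= ux sr] v vx.
  have gx : `|g u - g x| < e / 2.
    apply: rg; apply: lt_trans ux _; lra.
  have gv : `|g u - g v| < e / 2.
    apply: rg; rewrite /ball/=; move: ux vx; rewrite /ball/= !ltr_norml; lra.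
  by move: gx gv; rewrite !ltr_norml; lra.
move=> /(filterI (nbhs_right_gt (0 : R)))/filter_ex[r [r0 Hr]]; exists r => // u v uab; apply: Hr.
by rewrite /= in_itv.
Qed.

(** The approximant has to obey the same bound [B] on the whole line, since the tails are estimated
    with it. Bernstein polynomials provide this: they average values of [g], and [u x] lies in
    [0, 1] for every [x]. *)
Lemma trig_poly_approx (f : R -> R) (M B e : R) : continuous f -> 0 < M -> 0 < e ->
  (forall x, `|f x| <= B) ->
  exists p, [/\ trig_poly p, forall x, `|p x| <= B &
    forall x, `|x| <= M -> `|p x - f x| <= e].
Proof.
move=> cf M0 e0 fB.
have L0 : 0 < 2 * M by rewrite mulr_gt0.
(* Clamping keeps the argument of [asin] inside ]-1, 1[, where it is continuous. It changes nothing
   when [|x| <= M]: then [|x / (2 * M)| <= 1/2], hence the sine is at most 1/2 in modulus. This is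
   the reason for the scale [2 * M]. *)
pose clamp v : R := Num.max (- 2^-1) (Num.min 2^-1 v).
pose g v := f (2 * M * asin (clamp (2 * v - 1))).
pose u x := (1 + sin ((2 * M)^-1 * x)) / 2.
have u01 x : 0 <= u x <= 1.
  by rewrite /u; have := sin_geN1 ((2 * M)^-1 * x); have := sin_le1 ((2 * M)^-1 * x); lra.
have tu : trig_poly u.
  apply: trig_poly_ext (trig_polyZ 2^-1 (trig_polyD (trig_poly_cst 1)
    (trig_poly_sin (2 * M)^-1))) => x.
  by rewrite mulrC.
have clampP v : - 2^-1 <= clamp v <= 2^-1.
  by rewrite /clamp le_max lexx ge_max ge_min lexx /= andbT; lra.
have cg : continuous g.
  move=> v.
  have c1 : {for v, continuous (fun v : R => clamp (2 * v - 1))}.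
    apply: continuous_max; first exact: cvg_cst.
    apply: continuous_min; first exact: cvg_cst.
    apply: cvgB; last exact: cvg_cst.
    by apply: cvgM; [exact: cvg_cst|exact: cvg_id].
  have c2 : {for clamp (2 * v - 1), continuous (@asin R)}.
    by apply: continuous_asin; have := clampP (2 * v - 1); lra.
  have c3 : {for asin (clamp (2 * v - 1)), continuous (fun z => f (2 * M * z))}.
    have c4 : {for asin (clamp (2 * v - 1)), continuous (fun z : R => 2 * M * z)}.
      by apply: cvgM; [exact: cvg_cst|exact: cvg_id].
    exact: (continuous_comp c4 (cf _)).
  exact: (continuous_comp (continuous_comp c1 c2) c3).
have gu x : `|x| <= M -> g (u x) = f x.
  move=> xM; rewrite /g /u.
  have y2 : `|(2 * M)^-1 * x| <= 2^-1.
    rewrite normrM gtr0_norm ?invr_gt0// invfM -mulrA ler_piMr ?invr_ge0//.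
    by rewrite ler_pdivrMl// mulr1.
  have -> : 2 * ((1 + sin ((2 * M)^-1 * x)) / 2) - 1 = sin ((2 * M)^-1 * x) by field.
  move: y2; set y := _ * x => y2.
  have sy : `|sin y| <= 2^-1.
    have [y0|y0] := leP 0 y.
      rewrite ger0_norm; last by apply: sin_ge0_pi; have := @pi_ge2 R; move: y2; rewrite ler_norml; lra.
      by rewrite (le_trans (sin_lex y0))//; move: y2; rewrite ler_norml; lra.
    rewrite -normrN -sinN ger0_norm; last by apply: sin_ge0_pi; have := @pi_ge2 R; move: y2; rewrite ler_norml; lra.
    by rewrite (le_trans (sin_lex _))//; [lra|move: y2; rewrite ler_norml; lra].
  have -> : clamp (sin y) = sin y.
    by move: sy; rewrite ler_norml /clamp => sy; rewrite min_r ?max_r; lra.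
  rewrite sinK ?in_itv/=; last by have := @pi_ge2 R; move: y2; rewrite ler_norml; lra.
  by rewrite /y mulrA divff ?mul1r// gt_eqF.
have [r r0 gr] := unif_continuous_itv 0 1 cg (divr_gt0 e0 (ltr0n R 2)).
have B0 : 0 <= B by apply: le_trans (fB 0).
(* Large enough for the Chebyshev term [2 * B / (r^2 * n)] to be at most [e / 2]. *)
pose n := (Num.truncn (2 * B / (r ^+ 2 * (e / 2)))).+1.
have gB v : `|g v| <= B by exact: fB.
exists (fun x => bernstein n (fun k => g (k%:R / n%:R)) (u x)); split.
- exact: bernstein_trig.
- by move=> x; exact: bernstein_norm.
move=> x xM; rewrite -(gu x xM).
have := @bernstein_approx R n g (u x) B (e / 2) r isT (u01 x) r0 gB.
move=> /(_ (fun v _ vr => ltW (gr _ _ (u01 x) vr))) /le_trans; apply.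
suff : 2 * B / (r ^+ 2 * n%:R) <= e / 2 by lra.
have n0 : 0 < n%:R :> R by rewrite ltr0n.
rewrite ler_pdivrMr ?mulr_gt0 ?exprn_gt0//.
have -> : e / 2 * (r ^+ 2 * n%:R) = n%:R * (r ^+ 2 * (e / 2)) by ring.
rewrite -ler_pdivrMr ?mulr_gt0 ?divr_gt0 ?exprn_gt0//.
exact/ltW/truncnS_gt.
Qed.

End TrigonometricApproximation.

(** * Weak convergence from characteristic functions and tightness *)

Section WeakConvergenceCriterion.
Context (R : realType) (d : nat -> measure_display)
  (T : forall n, measurableType (d n)) (P : forall n, probability (T n) R)
  (Y : forall n, T n -> R) (mu : probability R R).
Arguments Y : clear implicits.
Hypothesis mY : forall n, measurable_fun setT (Y n).
Hypothesis cvg_cos : forall t : R,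
  (fun n => \int[P n]_w cos (t * Y n w)) @ \oo --> \int[mu]_x cos (t * x).
Hypothesis cvg_sin : forall t : R,
  (fun n => \int[P n]_w sin (t * Y n w)) @ \oo --> \int[mu]_x sin (t * x).
Hypothesis tight : forall e : R, 0 < e -> exists M : R,
  \forall n \near \oo, fine (P n [set w | M < `|Y n w|]) <= e.

Lemma trig_poly_integrable_comp p n : trig_poly p ->
  (P n).-integrable setT (EFin \o (p \o Y n)).
Proof.
move=> tp; have [B pB] := trig_poly_bounded tp.
apply: (@bounded_integrable _ _ _ _ _ B) => [|w]; last exact: pB.
exact: (measurableT_comp (trig_poly_measurable tp) (@mY n)).
Qed.

Lemma trig_poly_integrable (nu : probability R R) p : trig_poly p ->
  nu.-integrable setT (EFin \o p).
Proof.
move=> tp; have [B pB] := trig_poly_bounded tp.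
by apply: (@bounded_integrable _ _ _ _ _ B) => //; exact: trig_poly_measurable.
Qed.

Lemma cvg_trig_poly p : trig_poly p ->
  (fun n => \int[P n]_w p (Y n w)) @ \oo --> \int[mu]_x p x.
Proof.
elim=> {p} [t|t|f g tf hf tg hg|c f tf hf].
- exact: cvg_cos.
- exact: cvg_sin.
- rewrite RintegralD//; [|exact: trig_poly_integrable..].
  under eq_fun do rewrite RintegralD ?(trig_poly_integrable_comp _ tf) ?(trig_poly_integrable_comp _ tg)//.
  exact: cvgD.
- rewrite RintegralZl//; [|exact: trig_poly_integrable].
  under eq_fun do rewrite RintegralZl ?(trig_poly_integrable_comp _ tf)//.
  by apply: cvgM => //; exact: cvg_cst.
Qed.

Lemma probability_tight (e : R) : 0 < e -> exists M : R,
  fine (mu [set x | M < `|x|]) <= e.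
Proof.
move=> e0.
pose F n : set R := [set x | n%:R < `|x|].
have mF n : measurable (F n) by exact: measurable_norm_gt.
have : mu (F n) @[n --> \oo] --> mu (\bigcap_n F n).
  apply: nonincreasing_cvg_mu => //.
  - by rewrite (le_lt_trans (probability_le1 _ _))// ltry.
  - exact: bigcapT_measurable.
  - move=> m n mn; apply/subsetPset => x /=; apply: le_lt_trans.
    by rewrite ler_nat.
have -> : \bigcap_n F n = set0.
  apply/seteqP; split => // x /(_ (Num.truncn `|x|).+1 I) /=.
  by rewrite /F /= ltNge ltW// truncnS_gt.
rewrite measure0 => /fine_cvgP[_ /cvgrPdist_le/(_ _ e0)[N _ /(_ N (leqnn _))]].
rewrite /= sub0r normrN => h; exists N%:R.
exact: le_trans (ler_norm _) h.
Qed.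

(** A trigonometric polynomial close to [f] on a compact interval need not be close elsewhere; there
    the error is at most [2 * B], on a set whose mass is small by tightness, uniformly for large
    [n]. *)
Lemma cvg_in_distribution_charfun : cvg_in_distribution P Y mu.
Proof.
move=> f cf [B0 [_ fB0]].
pose B := B0 + 1.
have fB x : `|f x| <= B by apply: (fB0 B) => //; rewrite /B ltrDl.
have {fB0}Bge0 : 0 <= B by apply: le_trans (fB 0).
apply/cvgrPdist_le => e e0.
(* Two approximations cost [e' + 2 * B * e'] each and the convergence for the polynomial costs [e'];
   the sum is below [e]. *)
pose e' := e / (2 * (2 * B + 2)).
have e'0 : 0 < e' by rewrite divr_gt0// mulr_gt0// ltr_wpDl ?mulr_ge0.
have [M1 hM1] := tight e'0; have [M2 hM2] := probability_tight e'0.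
pose M := Num.max 1 (Num.max M1 M2).
have M0 : 0 < M by rewrite lt_max ltr01.
have [p [tp pB pf]] := trig_poly_approx cf M0 e'0 fB.
have mf : measurable_fun setT f by exact: continuous_measurable_fun.
have mu_approx : `|\int[mu]_x p x - \int[mu]_x f x| <= e' + 2 * B * e'.
  pose E : set R := [set x | M2 < `|x|].
  have mE : measurable E by exact: measurable_norm_gt.
  apply: le_trans (@ler_dist_Rintegral _ _ _ mu p f E e' (2 * B) _ _ mE _ _) _.
  - exact: trig_poly_integrable.
  - exact: bounded_integrable fB.
  - move=> x /negP; rewrite -leNgt => xM; apply: pf.
    by rewrite (le_trans xM)// !le_max lexx !orbT.
  - move=> x _; rewrite (le_trans (ler_normB _ _))//.
    by have := pB x; have := fB x; lra.
  - by rewrite lerD2l ler_wpM2l// mulr_ge0.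
have P_approx : \forall n \near \oo,
    `|\int[P n]_w p (Y n w) - \int[P n]_w f (Y n w)| <= e' + 2 * B * e'.
  apply: filterS hM1 => n hn.
  pose E : set (T n) := [set w | M1 < `|Y n w|].
  have mE : measurable E by exact: measurable_norm_gt.
  apply: le_trans (@ler_dist_Rintegral _ _ _ (P n) (p \o Y n) (f \o Y n) E e' (2 * B) _ _ mE _ _) _.
  - exact: trig_poly_integrable_comp.
  - by apply: (@bounded_integrable _ _ _ _ _ B) => [|w]; [exact: (measurableT_comp mf (@mY n))|exact: fB].
  - move=> x /negP; rewrite -leNgt => xM; apply: pf.
    by rewrite (le_trans xM)// !le_max lexx !orbT.
  - move=> x _; rewrite (le_trans (ler_normB _ _))//.
    by have := pB (Y n x); have := fB (Y n x); rewrite /=; lra.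
  - by rewrite lerD2l ler_wpM2l ?mulr_ge0.
have /cvgrPdist_le/(_ _ e'0) cp := cvg_trig_poly tp.
near=> n.
have h1 : `|\int[mu]_x p x - \int[P n]_w p (Y n w)| <= e' by near: n.
have h2 : `|\int[P n]_w p (Y n w) - \int[P n]_w f (Y n w)| <= e' + 2 * B * e' by near: n.
have -> : e = 2 * (e' + 2 * B * e') + 2 * e'.
  by rewrite /e'; field; rewrite gt_eqF// ltr_wpDl ?mulr_ge0.
move: h1 h2 mu_approx.
set a := \int[mu]_x p x; set b := \int[P n]_w p _; set a' := Rintegral mu _ _; set b' := Rintegral _ _ _.
have -> : a' - b' = (a - b) + (b - b') - (a - a') by ring.
move=> h1 h2 h3; rewrite (le_trans (ler_normB _ _))//.
have := ler_normD (a - b) (b - b'); lra.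
Unshelve. all: by end_near. Qed.

End WeakConvergenceCriterion.

Section Tightness.
Context (R : realType) (d : nat -> measure_display)
  (T : forall n, measurableType (d n)) (P : forall n, probability (T n) R)
  (Y : forall n, T n -> R) (mu : probability R R).
Arguments Y : clear implicits.

Lemma cvg_in_distribution_tight : (forall n, measurable_fun setT (Y n)) ->
  cvg_in_distribution P Y mu -> forall e : R, 0 < e -> exists2 m : R, 0 <= m &
  \forall n \near \oo, fine (P n [set w | m < `|Y n w|]) <= e.
Proof.
move=> mY Ymu e e0.
have [m0 hm0] := probability_tight mu (divr_gt0 e0 (ltr0n R 2)).
pose m := Num.max 0 m0; have m_ge0 : 0 <= m by rewrite le_max lexx.
exists (m + 1); first by rewrite addr_ge0.
(* Weak convergence tests continuous functions only, so this ramp is inserted between the indicators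
   of [|x| > m + 1] and [|x| > m]. *)
pose f (x : R) := Num.min 1 (Num.max 0 (`|x| - m)).
have f01 x : 0 <= f x <= 1.
  by rewrite /f le_min ler01 le_max lexx ge_min lexx.
have cf : continuous f.
  move=> x; suff : {for x, continuous (fun y : R => Num.min 1 (Num.max 0 (`|y| - m)))} by [].
  apply: continuous_min; first exact: cvg_cst.
  apply: continuous_max; first exact: cvg_cst.
  by apply: cvgB; [exact: norm_continuous|exact: cvg_cst].
have bf : bounded_fun f.
  exists 1; split; first by rewrite num_real.
  move=> M M1 x _; have /andP[f0 f1] := f01 x.
  by rewrite /= ger0_norm// (le_trans f1)// ltW.
have mf : measurable_fun setT f by exact: continuous_measurable_fun.
have fN1 x : `|f x| <= 1 by have /andP[f0 f1] := f01 x; rewrite ger0_norm.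
have fmu : \int[mu]_x f x <= e / 2.
  pose A : set R := [set x | m < `|x|].
  have mA : measurable A by exact: measurable_norm_gt.
  apply: le_trans hm0; apply: (@le_trans _ _ (fine (mu A))).
    rewrite -(Rintegral_indic mu mA); apply: le_Rintegral => //.
    - exact: bounded_integrable fN1.
    - exact: integrable_indic.
    move=> x _; have /andP[f0 f1] := f01 x; rewrite indicE.
    case: (boolP (_ \in _)) => //= /negP xA.
    rewrite /f ge_min; apply/orP; right; rewrite ge_max lexx subr_le0 leNgt.
    by apply/negP => mx; apply: xA; exact: mem_set.
  apply: fine_le; rewrite ?fin_num_measure//; first exact: measurable_norm_gt.
  apply: le_measure; rewrite ?inE//; first exact: measurable_norm_gt.
  by move=> x /=; apply: le_lt_trans; rewrite le_max lexx orbT.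
have /cvgrPdist_le/(_ _ (divr_gt0 e0 (ltr0n R 2))) := Ymu f cf bf.
apply: filterS => n; set y := \int[P n]_w _; set z := \int[mu]_x _ => zy.
have ye : y <= e by move: zy fmu; rewrite -/z ler_norml; lra.
apply: le_trans ye.
have mA : measurable [set w | m + 1 < `|Y n w|] by exact: measurable_norm_gt.
rewrite -(Rintegral_indic (P n) mA); apply: le_Rintegral => //.
- exact: integrable_indic.
- apply: (@bounded_integrable _ _ _ _ _ 1) => [|w]; last exact: fN1.
  exact: (measurableT_comp mf (mY n)).
move=> w _; have /andP[f0 f1] := f01 (Y n w); rewrite indicE.
case: (boolP (_ \in _)) => //= /set_mem /= mw.
rewrite /f le_min lexx le_max; apply/orP; right; move: mw; lra.
Qed.

End Tightness.

(** * Gaussian mixtures *)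

Section GaussianCharacteristicFunction.
Variable R : realType.
Local Notation mu := (@lebesgue_measure R).
Local Notation phi := (@normal_pdf R 0 1).

(** The explicit density and the Radon-Nikodym derivative have equal integrals over every measurable
    set, hence agree almost everywhere; the change of variables holds for the latter. *)
Lemma ge0_integral_normal_prob (m s : R) (f : R -> \bar R) :
  measurable_fun setT f -> (forall x, 0 <= f x)%E ->
  (\int[normal_prob m s]_x f x = \int[mu]_x (f x * (normal_pdf m s x)%:E))%E.
Proof.
move=> mf f0; pose N : probability (measurableTypeR R) R := normal_prob m s.
have dom : N `<< mu by exact: normal_prob_dominates.
rewrite -(Radon_Nikodym_SigmaFinite.change_of_variables dom f0 measurableT mf).
have iRN := Radon_Nikodym_SigmaFinite.f_integrable dom.
have mpdf : measurable_fun setT (fun x => (normal_pdf m s x)%:E).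
  by apply/measurable_EFinP; exact: measurable_normal_pdf.
apply: ae_eq_integral => //.
- by apply: emeasurable_funM => //; exact: measurable_int iRN.
- exact: emeasurable_funM.
apply: ae_eqe_mul2l; apply: integral_ae_eq => // E _ mE.
by rewrite -(Radon_Nikodym_SigmaFinite.f_integral dom mE).
Qed.

Lemma Rintegral_normal_prob (m s : R) (f : R -> R) (B : R) :
  measurable_fun setT f -> (forall x, `|f x| <= B) ->
  \int[normal_prob m s]_x f x = \int[mu]_x (f x * normal_pdf m s x).
Proof.
move=> mf fB; pose N : probability _ R := normal_prob m s.
have mf' : @measurable_fun _ _ (measurableTypeR R) R setT f by exact: mf.
have fi := @bounded_integrable _ _ _ N f B mf' fB.
have ipdf := integrable_normal_pdf m s.
have fpi : mu.-integrable setT (EFin \o (fun x => f x * normal_pdf m s x)).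
  rewrite (_ : EFin \o _ = (EFin \o f) \* (fun x => (normal_pdf m s x)%:E))%E//.
  apply: integrableMr => //; exists B; split; first by rewrite num_real.
  by move=> M BM x _; apply: le_trans (fB x) _; exact: ltW.
have ci := @bounded_integrable _ _ _ N (cst B) `|B| (measurable_cst B) (fun=> lexx _).
have cpi : mu.-integrable setT (EFin \o (fun x => B * normal_pdf m s x)).
  exact: (integrableZl measurableT B ipdf).
(* Adding [B] reduces to the nonnegative case; it is cancelled afterwards because the density has
   integral 1. *)
have pos x : 0 <= f x + B by have := fB x; rewrite ler_norml; lra.
have mfB : measurable_fun setT (fun x => f x + B).
  by apply: measurable_funD => //; exact: measurable_cst.
have : \int[N]_x (f x + B) = \int[mu]_x ((f x + B) * normal_pdf m s x).
  rewrite /Rintegral ge0_integral_normal_prob//.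
  exact/measurable_EFinP.
rewrite RintegralD// Rintegral_prob_cst.
under [RHS]eq_Rintegral do rewrite mulrDl.
rewrite RintegralD// RintegralZl//.
rewrite (_ : \int[mu]_x normal_pdf m s x = 1) ?mulr1; first exact: addIr.
by rewrite /Rintegral integral_normal_pdf.
Qed.

Lemma phiE (x : R) : phi x = normal_peak 1 * expR (- x ^+ 2 / 2).
Proof. by rewrite normal_pdfE ?oner_neq0// /normal_fun subr0 expr1n. Qed.

Lemma is_derive_phi (x : R) : is_derive x 1 phi (- x * phi x).
Proof.
rewrite phiE (_ : phi = fun x => normal_peak 1 * expR (- x ^+ 2 / 2)); last first.
  by apply/funext => y; rewrite phiE.
by apply: is_derive_eq; rewrite /GRing.scale/=; field.
Qed.

Lemma integrable_normM_phi : mu.-integrable setT (EFin \o (fun x => `|x| * phi x)).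
Proof.
(* A multiple of the density of variance 2 dominates: [|x| <= 1 + x^2/4 <= expR (x^2/4)], so
   [|x| * expR (- x^2/2)] is at most [expR (- x^2/4)]. The factor [c] below adjusts the
   normalisation. *)
pose s : R := Num.sqrt 2.
have s0 : s != 0 by rewrite gt_eqF// sqrtr_gt0.
pose c : R := normal_peak 1 / normal_peak s.
have ci : mu.-integrable setT (EFin \o (fun x => c * normal_pdf 0 s x)).
  exact: (integrableZl measurableT c (integrable_normal_pdf 0 s)).
apply: le_integrable ci => //.
  apply/measurable_EFinP.
  have mabs : measurable_fun setT (fun x : R => `|x|) by exact: normr_measurable.
  exact: (measurable_funM mabs (measurable_normal_pdf 0 1)).
move=> x _ /=; rewrite lee_fin phiE normal_pdfE// /c.
rewrite [leLHS]ger0_norm; last by rewrite !mulr_ge0 ?normal_peak_ge0 ?expR_ge0.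
rewrite [leRHS]ger0_norm; last first.
  by rewrite mulr_ge0 ?divr_ge0 ?mulr_ge0 ?normal_peak_ge0 ?expR_ge0.
rewrite [leRHS]mulrA divfK ?gt_eqF ?normal_peak_gt0// [leLHS]mulrCA.
rewrite ler_wpM2l ?normal_peak_ge0//.
rewrite /normal_fun subr0 /s sqr_sqrtr//.
have -> : - x ^+ 2 / 2 = - x ^+ 2 / (2 *+ 2) - x ^+ 2 / 4 by field.
rewrite expRD mulrCA ler_piMr ?expR_ge0//.
rewrite expRN ler_pdivrMr ?expR_gt0// mul1r.
apply: le_trans (expR_ge1Dx _).
have : 0 <= (1 - `|x| / 2) ^+ 2 by exact: sqr_ge0.
rewrite -[x ^+ 2]real_normK ?num_real//; lra.
Qed.

Lemma integrable_bounded_phi (f : R -> R) (B : R) : measurable_fun setT f ->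
  (forall x, `|f x| <= B) -> mu.-integrable setT (EFin \o (fun x => f x * phi x)).
Proof.
move=> mf fB.
rewrite (_ : EFin \o _ = (EFin \o f) \* (fun x => (phi x)%:E))%E//.
apply: integrableMr => //; last exact: integrable_normal_pdf.
exists B; split; first by rewrite num_real.
by move=> M BM x _; apply: le_trans (fB x) _; exact: ltW.
Qed.

Section ode.
Variable b : R.

(** The phase [b] treats both parts of the characteristic function at once: 0 gives the cosine and
    [- pi/2] the sine. The function is determined by the equation [u' = - t * u] and its value at
    0. *)
Let u (t : R) := \int[mu]_x (cos (t * x + b) * phi x).

Let mcos t : measurable_fun setT (fun x : R => cos (t * x + b)).
Proof.
apply: continuous_measurable_fun => x; apply: (@cvg_comp _ _ _ (fun x => t * x + b) cos); last exact: continuous_cos.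
apply: cvgD; last exact: cvg_cst.
by apply: cvgM; [exact: cvg_cst|exact: cvg_id].
Qed.

Let msin t : measurable_fun setT (fun x : R => sin (t * x + b)).
Proof.
apply: continuous_measurable_fun => x; apply: (@cvg_comp _ _ _ (fun x => t * x + b) sin); last exact: continuous_sin.
apply: cvgD; last exact: cvg_cst.
by apply: cvgM; [exact: cvg_cst|exact: cvg_id].
Qed.

Let h (t x : R) := sin (t * x + b) * phi x.
Let dh (t x : R) := t * (cos (t * x + b) * phi x) - sin (t * x + b) * (x * phi x).

Let is_derive_h t (x : R) : is_derive x 1 (h t) (dh t x).
Proof.
have dphi := is_derive_phi x.
by apply: is_derive_eq; rewrite /GRing.scale/= /dh; ring.
Qed.

Let ixsin t : mu.-integrable setT (EFin \o (fun x => sin (t * x + b) * (x * phi x))).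
Proof.
apply: le_integrable integrable_normM_phi => //.
  apply/measurable_EFinP.
  have mxphi : measurable_fun setT (fun x : R => x * phi x).
    exact: (measurable_funM (measurable_id (D := setT)) (measurable_normal_pdf 0 1)).
  exact: (measurable_funM (msin t) mxphi).
move=> x _ /=; rewrite lee_fin !normrM normr_id ler_piMl ?mulr_ge0//.
exact: sin_max.
Qed.

Let icos t : mu.-integrable setT (EFin \o (fun x => cos (t * x + b) * phi x)).
Proof. by apply: (@integrable_bounded_phi _ 1) => // x; exact: cos_max. Qed.

Let continuous_dh t : continuous (dh t).
Proof.
move=> x; apply/differentiable_continuous/derivable1_diffP.
have dphi := is_derive_phi x.
by apply: ex_derive.
Qed.

(** Gaussian integration by parts: [h] vanishes at both infinities. Of the two terms of [dh], the
    first integrates to [t * u t], and the second is the derivative of [u] obtained under the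
    integral sign; this is the source of the differential equation. *)
Lemma Rintegral_dh t : \int[mu]_x dh t x = 0.
Proof.
have idh : mu.-integrable setT (EFin \o dh t).
  exact: (integrable_EFinB (integrable_EFinZ t (icos t)) (ixsin t)).
pose I n : set R := `[- n.+1%:R, n.+1%:R]%classic.
have FTC n : (\int[mu]_(x in I n) (dh t x)%:E)%E =
    (h t n.+1%:R - h t (- n.+1%:R))%:E.
  apply: continuous_FTC2.
  - by rewrite gtrN.
  - by apply: continuous_subspaceT; exact: continuous_dh.
  - have dd (x : R) : derivable (h t) x 1 by case: (is_derive_h t x).
    have cc (x : R) : {for x, continuous (h t)}.
      exact/differentiable_continuous/derivable1_diffP.
    split => //; [apply: cvg_at_right_filter|apply: cvg_at_left_filter]; exact: cc.
  - by move=> x _; rewrite derive1E; exact: derive_val.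
have cvg1 : (\int[mu]_(x in I n) (dh t x)%:E)%E
    @[n --> \oo] --> (\int[mu]_x (dh t x)%:E)%E.
  under eq_fun do rewrite integral_mkcond.
  apply: (@dominated_cvg _ _ _ mu setT measurableT
    (fun n => (EFin \o dh t) \_ (I n)) (EFin \o dh t)
    (EFin \o (fun x => `|dh t x|))) => //.
  - move=> n; apply/(measurable_restrictT _ _).1; first exact: measurable_itv.
    by apply: measurable_funTS; exact: (measurable_int _ idh).
  - move=> x _; apply: cvg_near_cst; near=> n.
    rewrite patchE mem_set// /I /= in_itv /= -ler_norml.
    near: n; exists (Num.truncn `|x|) => // n /= xn.
    by rewrite (le_trans (ltW (truncnS_gt _)))// ler_nat.
  - exact: (integrable_norm idh).
  - move=> n x _; rewrite patchE; case: ifPn => _ /=; first by rewrite lee_fin.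
    by rewrite normr0 lee_fin.
(* Decay like [1/x] is enough for the boundary terms: [expR (x^2/2) >= 1 + x^2/2 >= x]. *)
have phi_le (x : R) : 0 < x -> phi x <= normal_peak 1 * x^-1.
  move=> x0; rewrite phiE ler_wpM2l ?normal_peak_ge0// mulNr expRN.
  rewrite lef_pV2 ?posrE ?expR_gt0//; apply: le_trans (expR_ge1Dx _).
  by have := sqr_ge0 (x - 1); rewrite sqrrB expr1n mulr1; lra.
have phiN (x : R) : phi (- x) = phi x by rewrite !phiE sqrrN.
have cvg0 : (h t n.+1%:R - h t (- n.+1%:R)) @[n --> \oo] --> (0 : R).
  apply/norm_cvg0P.
  have h0 : (2 * normal_peak 1 * n.+1%:R^-1 : R) @[n --> \oo] --> (0 : R).
    rewrite -(mulr0 (2 * normal_peak 1)); apply: cvgM; first exact: cvg_cst.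
    exact: cvg_harmonic.
  apply: (squeeze_cvgr _ (cvg_cst 0) h0); near=> n.
  rewrite normr_ge0 /=; apply: le_trans (ler_normB _ _) _.
  rewrite /h !normrM phiN (ger0_norm (normal_pdf_ge0 0 1 _)).
  have := phi_le n.+1%:R (ltr0Sn _ _); have := normal_pdf_ge0 0 1 (n.+1%:R : R).
  have := sin_max (t * n.+1%:R + b); have := sin_max (t * - n.+1%:R + b).
  set s1 := `|sin _|; set s2 := `|sin _|; set p := phi _ => s11 s21 p0 pl.
  have : s1 * p <= p by rewrite ler_piMl.
  have : s2 * p <= p by rewrite ler_piMl.
  by rewrite -mulrA; move: pl; set q := _ / _; lra.
rewrite (funext FTC) in cvg1.
have : (\int[mu]_x (dh t x)%:E)%E = 0%E.
  apply: (cvg_unique _ cvg1) => //.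
  by apply: cvg_EFin => //; exact: nearW.
by rewrite /Rintegral => ->.
Unshelve. all: by end_near. Qed.

Let derivable_u (t : R) : is_derive t 1 u (- t * u t).
Proof.
pose f (s x : R) := cos (s * x + b) * phi x.
have dfE (s x : R) : is_derive s 1 (f ^~ x) (- (sin (s * x + b) * (x * phi x))).
  by apply: is_derive_eq; rewrite /GRing.scale/=; ring.
have It : `]t - 1, t + 1[%classic t by rewrite /= in_itv/= ltrBlDr !ltrDl ltr01.
have d1 (s x : R) : derivable (f ^~ x) s 1 by case: (dfE s x).
have bnd (s x : R) : `|partial1of2 f s x| <= `|x| * phi x.
  rewrite partial1of2E derive_val normrN normrM.
  rewrite (le_trans (ler_piMl (normr_ge0 _) (sin_max _)))//.
  by rewrite normrM (ger0_norm (normal_pdf_ge0 0 1 _)).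
have ints (s : R) : mu.-integrable setT (EFin \o f s) by exact: icos.
have G0 (x : R) : 0 <= `|x| * phi x by rewrite mulr_ge0// normal_pdf_ge0.
have dut : derivable u t 1.
  apply: (@derivable_under_integral _ _ _ mu f _ measurableT _ _ _ It
    (fun s _ => ints s) (fun s x _ _ => d1 s x) _ G0 integrable_normM_phi
    (fun s x _ _ => bnd s x)).
apply: DeriveDef => //.
rewrite -derive1E (@differentiation_under_integral _ _ _ mu f _ measurableT _ _ _ It
    (fun s _ => ints s) (fun s x _ _ => d1 s x) _ G0 integrable_normM_phi
    (fun s x _ _ => bnd s x)).
under eq_Rintegral do rewrite partial1of2E derive_val.
have := Rintegral_dh t.
rewrite RintegralB//; last exact: (integrable_EFinZ t (icos t)).
rewrite RintegralZl// -/(u t) => /eqP; rewrite subr_eq0 => /eqP hh.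
under eq_Rintegral do rewrite -mulN1r.
by rewrite RintegralZl// -hh; ring.
Qed.

Lemma Rintegral_cosD_phi (t : R) : u t = cos b * expR (- t ^+ 2 / 2).
Proof.
pose v s := u s * expR (s ^+ 2 / 2).
have dv (s : R) : is_derive s 1 v 0.
  have du := derivable_u s.
  by apply: is_derive_eq; rewrite /GRing.scale/=; field.
have := is_derive_0_is_cst t 0 dv.
rewrite /v expr0n/= mul0r expR0 mulr1 => /(congr1 (fun z => z * expR (- t ^+ 2 / 2))).
rewrite -mulrA -expRD mulNr subrr expR0 mulr1 => ->; congr (_ * _).
rewrite /u; under eq_Rintegral do rewrite mul0r add0r.
rewrite RintegralZl//; last exact: integrable_normal_pdf.
by rewrite /Rintegral integral_normal_pdf mulr1.
Qed.

End ode.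

Lemma cos_normal_prob (t : R) :
  \int[normal_prob 0 1]_x cos (t * x) = expR (- t ^+ 2 / 2).
Proof.
rewrite (@Rintegral_normal_prob _ _ _ 1); last by move=> x; exact: cos_max.
  by under eq_Rintegral do rewrite -[t * _]addr0; rewrite Rintegral_cosD_phi cos0 mul1r.
exact: (trig_poly_measurable (trig_poly_cos t)).
Qed.

Lemma sin_normal_prob (t : R) : \int[normal_prob 0 1]_x sin (t * x) = 0.
Proof.
rewrite (@Rintegral_normal_prob _ _ _ 1); last by move=> x; exact: sin_max.
  under eq_Rintegral do rewrite -cosBpihalf.
  by rewrite Rintegral_cosD_phi cosN cos_pihalf mul0r.
exact: (trig_poly_measurable (trig_poly_sin t)).
Qed.

End GaussianCharacteristicFunction.

Section GaussianMixture.
Context d (T : measurableType d) (R : realType) (P : probability T R).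
Variable v : {RV P >-> R}.
Hypothesis v0 : forall w, 0 <= v w.

Let N : probability _ R := @normal_prob R 0 1.
Let PN := (P \x N)%E.

Let Z (z : T * measurableTypeR R) : R := Num.sqrt (v z.1) * z.2.

Let mZ : measurable_fun setT Z.
Proof.
apply: measurable_funM.
  apply: (measurableT_comp (f := Num.sqrt \o v)) => //.
  apply: measurableT_comp => //.
  by apply: continuous_measurable_fun; exact: sqrt_continuous.
exact: measurable_snd.
Qed.

HB.instance Definition _ := @isMeasurableFun.Build _ _ _ _ Z mZ.

(** The product measure supplies a standard normal independent of [v]. Exhibiting the limit law
    makes [t |-> E exp(- v t^2/2)] a characteristic function by construction. *)
Definition gaussian_mixture : probability R R := distribution PN (Z : {mfun _ >-> _}).

Lemma Rintegral_gaussian_mixture (f : R -> R) (B : R) : measurable_fun setT f ->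
  (forall x, `|f x| <= B) ->
  \int[gaussian_mixture]_x f x =
  \int[P]_w \int[N]_x f (Num.sqrt (v w) * x).
Proof.
move=> mf fB.
have mfZ : measurable_fun setT (f \o Z) by exact: measurableT_comp.
have fZi := @bounded_integrable _ _ _ PN (f \o Z) B mfZ (fun z => fB (Z z)).
rewrite /Rintegral /gaussian_mixture integral_distribution//; last first.
  exact/measurable_EFinP.
congr fine.
rewrite -(integral12_prod_meas1 fZi).
apply: eq_integral => w _.
have mfw : measurable_fun setT (fun x : measurableTypeR R => f (Num.sqrt (v w) * x)).
  have ms : measurable_fun setT (fun x : R => Num.sqrt (v w) * x).
    exact: (measurable_funM (measurable_cst _) (measurable_id (D := setT))).
  exact: (measurableT_comp mf ms).
have := @bounded_integrable _ _ _ N _ B mfw (fun x => fB _).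
by move=> /(integrable_fin_num measurableT) ?; rewrite fineK.
Qed.

Lemma cos_gaussian_mixture (t : R) :
  \int[gaussian_mixture]_x cos (t * x) = \int[P]_w expR (- (v w * t ^+ 2) / 2).
Proof.
rewrite (@Rintegral_gaussian_mixture _ 1); last by move=> x; exact: cos_max.
  apply: eq_Rintegral => w _.
  under eq_Rintegral do rewrite mulrA.
  by rewrite cos_normal_prob exprMn sqr_sqrtr// [t ^+ 2 * _]mulrC.
exact: (trig_poly_measurable (trig_poly_cos t)).
Qed.

Lemma sin_gaussian_mixture (t : R) : \int[gaussian_mixture]_x sin (t * x) = 0.
Proof.
rewrite (@Rintegral_gaussian_mixture _ 1); last by move=> x; exact: sin_max.
  rewrite -(Rintegral_prob_cst P 0); apply: eq_Rintegral => w _.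
  by under eq_Rintegral do rewrite mulrA; exact: sin_normal_prob.
exact: (trig_poly_measurable (trig_poly_sin t)).
Qed.

End GaussianMixture.

(** * Stopped martingales *)

Section ConditionallyCentered.
Context d (T : measurableType d) (R : realType) (P : probability T R).
Implicit Types (G : set (set T)) (f g X Z : T -> R).

Lemma measurable_wrtP G f : sigma_algebra setT G ->
  measurable_wrt G f <-> measurable_fun (setT : set (g_sigma_algebraType G)) f.
Proof.
move=> sG; split=> [Gf _ B mB|mf B mB].
  by rewrite setTI; apply: sub_sigma_algebra; exact: Gf.
by have := mf measurableT B mB; rewrite setTI /measurable/= sigma_algebra_id.
Qed.

Lemma measurable_wrt_sub G f : Defs.sub_sigma_algebra G -> measurable_wrt G f ->
  measurable_fun setT f.
Proof. by move=> [_ Gm] Gf _ B mB; rewrite setTI; apply: Gm; exact: Gf. Qed.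

Lemma sum_nat_lt_minn N j : (\sum_(i < N) (i < j)%N = minn j N)%N.
Proof.
elim: N => [|N IH]; first by rewrite big_ord0 minn0.
by rewrite big_ord_recr /= IH; lia.
Qed.

(** The sum counts the positive multiples of [1/m] up to [z], so it rounds [z] down to the grid of
    mesh [1/m]. Written with superlevel conditions, it becomes a sum of indicators when [z] is a
    random variable. *)
Lemma layer_approx (m N : nat) (z : R) : (0 < m)%N -> 0 <= z -> m%:R * z < N%:R ->
  `|z - \sum_(i < N) m%:R^-1 * ((i.+1%:R <= m%:R * z)%R : nat)%:R| <= m%:R^-1.
Proof.
move=> m0 z0 zN; have mR : 0 < m%:R :> R by rewrite ltr0n.
have mz0 : 0 <= m%:R * z by rewrite mulr_ge0// ltW.
rewrite -mulr_sumr -natr_sum.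
under eq_bigr do rewrite -truncn_ge_nat//.
rewrite sum_nat_lt_minn (minn_idPl _); last first.
  by rewrite ltnW// truncn_lt_nat// ler0n.
have /andP[t1 t2] := truncn_itv mz0.
rewrite -(ler_pM2l mR) -{1}(ger0_norm (ltW mR)) -normrM mulrBr mulrA mulfV ?gt_eqF// mul1r.
by rewrite ler_norml; move: t2; rewrite -natr1; lra.
Qed.

(** The definition of conditional expectation tests [X] on sets of [G] only. The superlevel sets of
    [Z] belong to [G], and [Z] is within [1/m] of a combination of their indicators, so the integral
    is at most [E|X| / m]. *)
Lemma Rintegral_mul_centered_ge0 G X Z (B : R) : Defs.sub_sigma_algebra G ->
  P.-integrable setT (EFin \o X) -> is_cond_expectation P G X (cst 0) ->
  measurable_wrt G Z -> (forall w, 0 <= Z w <= B) ->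
  \int[P]_w (X w * Z w) = 0.
Proof.
move=> sG iX [_ _ cX] mZ ZB.
have mZT := measurable_wrt_sub sG mZ.
have mX : measurable_fun setT X by apply/measurable_EFinP; exact: measurable_int iX.
pose A (c : R) := [set w | c <= Z w].
have GA c : G (A c).
  rewrite [A c](_ : _ = Z @^-1` `[c, +oo[%classic); first by apply: mZ; exact: measurable_itv.
  by apply/seteqP; split => w /=; rewrite in_itv/= andbT.
have mA c : measurable (A c) by case: sG => _; apply.
have iXA c : P.-integrable setT (EFin \o (fun w => X w * \1_(A c) w)).
  apply: le_integrable iX => //.
    by apply/measurable_EFinP; apply: measurable_funM => //; exact: measurable_indic.
  by move=> w _ /=; rewrite lee_fin normrM ler_piMr// indicE; case: (_ \in _); rewrite ?normr1 ?normr0.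
have XA c : \int[P]_w (X w * \1_(A c) w) = 0.
  transitivity (\int[P]_(w in A c) X w).
    rewrite [RHS]Rintegral_mkcond; apply: eq_Rintegral => w _.
    by rewrite patchE indicE; case: (_ \in _); rewrite ?mulr1 ?mulr0.
  rewrite -(cX _ (GA c)) Rintegral_mkcond -[RHS](Rintegral_prob_cst P).
  by apply: eq_Rintegral => w _; rewrite patchE; case: ifP.
have iXZ : P.-integrable setT (EFin \o (fun w => X w * Z w)).
  apply: (le_integrable _ _ _ (integrable_EFinZ B iX)) => //.
    by apply/measurable_EFinP; exact: measurable_funM.
  move=> w _ /=; rewrite lee_fin !normrM mulrC ler_wpM2r//.
  by have /andP[z0 zB] := ZB w; rewrite !ger0_norm// (le_trans z0).
have iXn := integrable_norm iX.
apply/eqP; rewrite -normr_le0; apply/ler_addgt0Pr => e e0; rewrite add0r.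
pose C := \int[P]_w `|X w|.
have C0 : 0 <= C by apply: Rintegral_ge0.
pose m := (Num.truncn (C / e)).+1.
have m0 : 0 < m%:R :> R by rewrite ltr0n.
(* Enough layers to reach above every value of [m * Z]. *)
pose N := (Num.truncn (m%:R * B)).+1.
pose Zm w := \sum_(i < N) m%:R^-1 * (X w * \1_(A (i.+1%:R / m%:R)) w).
have iZm n : P.-integrable setT
    (EFin \o (fun w => \sum_(i < n) m%:R^-1 * (X w * \1_(A (i.+1%:R / m%:R)) w))).
  elim: n => [|n IH].
    rewrite (_ : EFin \o _ = cst 0%E); first exact: integrable0.
    by apply/funext => w /=; rewrite big_ord0.
  rewrite (_ : EFin \o _ = EFin \o (fun w =>
      (\sum_(i < n) m%:R^-1 * (X w * \1_(A (i.+1%:R / m%:R)) w)) +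
      m%:R^-1 * (X w * \1_(A (n.+1%:R / m%:R)) w))).
    exact: (integrable_EFinD IH (integrable_EFinZ _ (iXA _))).
  by apply/funext => w /=; rewrite big_ord_recr.
have Zm0 n : \int[P]_w (\sum_(i < n) m%:R^-1 * (X w * \1_(A (i.+1%:R / m%:R)) w)) = 0.
  elim: n => [|n IH].
    by under eq_Rintegral do rewrite big_ord0; rewrite Rintegral_prob_cst.
  under eq_Rintegral do rewrite big_ord_recr/=.
  rewrite RintegralD//; [|exact: iZm|exact: (integrable_EFinZ _ (iXA _))].
  by rewrite IH RintegralZl// XA mulr0 addr0.
have -> : \int[P]_w (X w * Z w) = \int[P]_w (X w * Z w - Zm w).
  by rewrite (RintegralB measurableT iXZ (iZm N)) [X in _ - X](Zm0 N) subr0.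
apply: le_trans (le_normr_Rintegral measurableT (integrable_EFinB iXZ (iZm N))) _.
apply: (@le_trans _ _ (\int[P]_w (m%:R^-1 * `|X w|))).
  apply: le_Rintegral => //.
  - exact: (integrable_norm (integrable_EFinB iXZ (iZm N))).
  - exact: integrable_EFinZ.
  move=> w _; have /andP[z0 zB] := ZB w.
  have -> : X w * Z w - Zm w = X w * (Z w -
      \sum_(i < N) m%:R^-1 * ((i.+1%:R <= m%:R * Z w)%R : nat)%:R).
    rewrite mulrBr /Zm mulr_sumr; congr (_ - _); apply: eq_bigr => i _.
    rewrite mulrCA; congr (_ * (_ * _)); rewrite indicE; congr (_ %:R); congr nat_of_bool.
    by apply/idP/idP; rewrite inE /A/= ler_pdivrMr// mulrC.
  rewrite normrM mulrC ler_wpM2r//; apply: layer_approx => //.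
  by rewrite (le_lt_trans _ (truncnS_gt _))// ler_wpM2l// ltW.
rewrite RintegralZl//= -/C mulrC ler_pdivrMr// -ler_pdivrMl// mulrC.
exact/ltW/truncnS_gt.
Qed.

(** The signed case follows from the nonnegative one for [Z + B]; the added part is [B * E[X]],
    which is 0 by the case of the constant 1. *)
Lemma Rintegral_mul_centered G X Z (B : R) : Defs.sub_sigma_algebra G ->
  P.-integrable setT (EFin \o X) -> is_cond_expectation P G X (cst 0) ->
  measurable_wrt G Z -> (forall w, `|Z w| <= B) ->
  P.-integrable setT (EFin \o (fun w => X w * Z w)) /\
  \int[P]_w (X w * Z w) = 0.
Proof.
move=> sG iX cX mZ ZB.
have mX : measurable_fun setT X by apply/measurable_EFinP; exact: measurable_int iX.
have mZT := measurable_wrt_sub sG mZ.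
have iXZ : P.-integrable setT (EFin \o (fun w => X w * Z w)).
  apply: (le_integrable _ _ _ (integrable_EFinZ B iX)) => //.
    by apply/measurable_EFinP; exact: measurable_funM.
  move=> w _ /=; rewrite lee_fin !normrM mulrC ler_wpM2r//.
  exact: le_trans (ZB w) (ler_norm _).
split => //.
have mZB : measurable_wrt G (fun w => Z w + B).
  apply/measurable_wrtP; first by case: sG.
  apply: measurable_funD; last exact: measurable_cst.
  by apply/measurable_wrtP => //; case: sG.
have h := @Rintegral_mul_centered_ge0 _ _ _ (B + B) sG iX cX mZB.
have h1 : \int[P]_w (X w * 1) = 0.
  apply: (@Rintegral_mul_centered_ge0 _ _ (cst 1) 1 sG iX cX) => [|w]; last by rewrite /= ler01 lexx.
  apply/measurable_wrtP; first by case: sG.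
  exact: measurable_cst.
have h2 : \int[P]_w (X w * (Z w + B)) = 0.
  by apply: h => w; have := ZB w; rewrite ler_norml; lra.
have h3 : \int[P]_w X w = 0 by move: h1; under eq_Rintegral do rewrite mulr1.
move: h2; under eq_Rintegral do rewrite mulrDr [X _ * B]mulrC.
rewrite RintegralD//; last exact: integrable_EFinZ.
by rewrite RintegralZl// h3 mulr0 addr0.
Qed.

End ConditionallyCentered.

Section IntegralBound.
Context d (T : measurableType d) (R : realType) (P : probability T R).

Lemma Rintegral_le_indic (f h : T -> R) (E1 E2 : set T) (a b e : R) :
  P.-integrable setT (EFin \o f) -> P.-integrable setT (EFin \o h) ->
  measurable E1 -> measurable E2 ->
  (forall w, f w <= a + \1_E1 w + b * \1_E2 w + e * h w) ->
  \int[P]_w f w <= a + fine (P E1) + b * fine (P E2) + e * \int[P]_w h w.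
Proof.
move=> fi hi mE1 mE2 fle.
have ai : P.-integrable setT (EFin \o (fun _ : T => a)).
  by apply: (@bounded_integrable _ _ _ _ _ `|a|) => //; exact: measurable_cst.
have i1 : P.-integrable setT (EFin \o (\1_E1 : T -> R)) by exact: integrable_indic.
have i2 : P.-integrable setT (EFin \o (\1_E2 : T -> R)) by exact: integrable_indic.
have bi2 := integrable_EFinZ b i2.
have ehi := integrable_EFinZ e hi.
have ai1 := integrable_EFinD ai i1.
have ai12 := integrable_EFinD ai1 bi2.
apply: le_trans (le_Rintegral measurableT fi (integrable_EFinD ai12 ehi) _) _ => //.
by rewrite !RintegralD// !RintegralZl// Rintegral_prob_cst !Rintegral_indic.
Qed.

End IntegralBound.

Lemma ler_dist_expRN (R : realType) (a b : R) : 0 <= a -> 0 <= b ->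
  `|expR (- a) - expR (- b)| <= `|a - b|.
Proof.
wlog ab : a b / a <= b => [hw a0 b0|a0 b0].
  have [|/ltW] := leP a b => ab; first exact: hw.
  by rewrite distrC [leRHS]distrC; exact: hw.
rewrite ger0_norm ?subr_ge0 ?ler_expR ?lerN2// [leRHS]ler0_norm ?subr_le0//.
rewrite opprB -(addrNK a b) opprD expRD -{1}[expR (- a)]mul1r -mulrBl.
have e1 : expR (- a) <= 1 by rewrite expR_le1 oppr_le0.
have := expR_ge1Dx (- (b - a)) => h.
apply: (@le_trans _ _ (1 - expR (- (b - a)))); last by rewrite addrK; lra.
rewrite ler_piMr// subr_ge0 expR_le1 oppr_le0; lra.
Qed.

Section MeasurableWrt.
Context d (T : measurableType d) (R : realType).
Variables (G : set (set T)) (sG : Defs.sub_sigma_algebra G).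
Implicit Types f g : T -> R.

Lemma measurable_wrt_cst (c : R) : measurable_wrt G (fun=> c).
Proof. by apply/(measurable_wrtP _ sG.1); exact: measurable_cst. Qed.

Lemma measurable_wrtD f g : measurable_wrt G f -> measurable_wrt G g ->
  measurable_wrt G (fun w => f w + g w).
Proof.
move=> /(measurable_wrtP _ sG.1) mf /(measurable_wrtP _ sG.1) mg.
by apply/(measurable_wrtP _ sG.1); exact: measurable_funD.
Qed.

Lemma measurable_wrtM f g : measurable_wrt G f -> measurable_wrt G g ->
  measurable_wrt G (fun w => f w * g w).
Proof.
move=> /(measurable_wrtP _ sG.1) mf /(measurable_wrtP _ sG.1) mg.
by apply/(measurable_wrtP _ sG.1); exact: measurable_funM.
Qed.

Lemma measurable_wrt_le_if f (c a b : R) : measurable_wrt G f ->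
  measurable_wrt G (fun w => if f w <= c then a else b).
Proof.
move=> /(measurable_wrtP _ sG.1) mf; apply/(measurable_wrtP _ sG.1).
apply: measurable_fun_ifT; [|exact: measurable_cst..].
exact: (measurable_fun_ler mf (measurable_cst c)).
Qed.

Lemma measurable_wrt_comp f (g : R -> R) : measurable_fun setT g ->
  measurable_wrt G f -> measurable_wrt G (g \o f).
Proof.
move=> mg /(measurable_wrtP _ sG.1) mf; apply/(measurable_wrtP _ sG.1).
exact: measurableT_comp mf.
Qed.

End MeasurableWrt.

(** * Stopping at a level of the quadratic variation *)

Section StoppedMartingale.
Context d (T : measurableType d) (R : realType) (P : probability T R).
Variables (F : nat -> set (set T)) (Y : nat -> T -> R) (k : nat).
Hypothesis F_filtration : filtration F.
Hypothesis Y_meas : forall j, (j < k)%N -> measurable_wrt (F j.+1) (Y j).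
Hypothesis Y_int : forall j, (j < k)%N -> P.-integrable setT (EFin \o Y j).
Hypothesis Y_centered : forall j, (j < k)%N ->
  is_cond_expectation P (F j) (Y j) (cst 0).
Variable M : T -> R.
Hypothesis M_int : P.-integrable setT (EFin \o M).
Hypothesis M_ge0 : forall w, 0 <= M w.
Hypothesis Y_le_M : forall j w, (j < k)%N -> Y j w ^+ 2 <= M w.
Variable c : R.
Hypothesis c_ge0 : 0 <= c.
Variable t : R.

Definition quad_var n w : R := \sum_(j < n) Y j w ^+ 2.

(** Indices start at 0: [Y n] is measurable for [F n.+1] and centered given [F n]. The sum
    [quad_var n] excludes the current square, so the indicator is [F n]-measurable and the increment
    stays centered; conversely, the last retained square may overshoot [c]. *)
Definition stopped n w : R := Y n w * (if quad_var n w <= c then 1 else 0).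

Definition stopped_sum n w : R := \sum_(j < n) stopped j w.

Definition stopped_prod n w : R[i] := mcleish n (fun j => t * stopped j w).

Let sF j : Defs.sub_sigma_algebra (F j). Proof. exact: F_filtration.1. Qed.

Let meas_le i j (f : T -> R) : (i <= j)%N -> measurable_wrt (F i) f -> measurable_wrt (F j) f.
Proof. by move=> ij mf B mB; apply: (F_filtration.2 _ _ ij); exact: mf. Qed.

Lemma quad_var_meas n : (n <= k)%N -> measurable_wrt (F n) (quad_var n).
Proof.
elim: n => [|n IH] nk.
  rewrite (_ : quad_var 0 = fun=> 0); first exact: measurable_wrt_cst.
  by apply/funext => w; rewrite /quad_var big_ord0.
rewrite (_ : quad_var n.+1 = fun w => quad_var n w + Y n w * Y n w); last first.
  by apply/funext => w; rewrite /quad_var big_ord_recr.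
apply: measurable_wrtD => //; first by apply: meas_le (IH (ltnW nk)).
by apply: measurable_wrtM => //; exact: Y_meas.
Qed.

Lemma quad_var_mono m n w : (m <= n)%N -> quad_var m w <= quad_var n w.
Proof.
move=> mn; rewrite /quad_var -(big_mkord xpredT (fun j => Y j w ^+ 2)).
rewrite -[leRHS](big_mkord xpredT (fun j => Y j w ^+ 2)).
rewrite (big_cat_nat (leq0n m) mn)//= lerDl sumr_ge0// => i _.
exact: sqr_ge0.
Qed.

Let stopped_le n w : stopped n w ^+ 2 <= Y n w ^+ 2.
Proof.
by rewrite /stopped; case: ifP; rewrite ?mulr1// mulr0 expr0n sqr_ge0.
Qed.

Lemma stopped_meas n : (n < k)%N -> measurable_wrt (F n.+1) (stopped n).
Proof.
move=> nk; apply: measurable_wrtM => //; first exact: Y_meas.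
apply: measurable_wrt_le_if => //.
by apply: meas_le (quad_var_meas (ltnW nk)).
Qed.

Lemma stopped_sum_meas n : (n <= k)%N -> measurable_wrt (F n) (stopped_sum n).
Proof.
elim: n => [|n IH] nk.
  rewrite (_ : stopped_sum 0 = fun=> 0); first exact: measurable_wrt_cst.
  by apply/funext => w; rewrite /stopped_sum big_ord0.
rewrite (_ : stopped_sum n.+1 = fun w => stopped_sum n w + stopped n w); last first.
  by apply/funext => w; rewrite /stopped_sum big_ord_recr.
apply: measurable_wrtD => //; first by apply: meas_le (IH (ltnW nk)).
exact: stopped_meas.
Qed.

Lemma Re_stopped_prodS n w : complex.Re (stopped_prod n.+1 w) =
  complex.Re (stopped_prod n w) - t * stopped n w * complex.Im (stopped_prod n w).
Proof.
rewrite /stopped_prod /mcleish big_ord_recr /=.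
by case: (\prod_(_ < n) _) => a b /=; ring.
Qed.

Lemma Im_stopped_prodS n w : complex.Im (stopped_prod n.+1 w) =
  complex.Im (stopped_prod n w) + t * stopped n w * complex.Re (stopped_prod n w).
Proof.
rewrite /stopped_prod /mcleish big_ord_recr /=.
by case: (\prod_(_ < n) _) => a b /=; ring.
Qed.

Lemma stopped_prod_meas n : (n <= k)%N ->
  measurable_wrt (F n) (fun w => complex.Re (stopped_prod n w)) /\
  measurable_wrt (F n) (fun w => complex.Im (stopped_prod n w)).
Proof.
elim: n => [|n IH] nk.
  split.
    rewrite (_ : (fun _ => _) = fun=> 1); first exact: measurable_wrt_cst.
    by apply/funext => w; rewrite /stopped_prod /mcleish big_ord0.
  rewrite (_ : (fun _ => _) = fun=> 0); first exact: measurable_wrt_cst.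
  by apply/funext => w; rewrite /stopped_prod /mcleish big_ord0.
have [/(meas_le (leqnSn n)) mR /(meas_le (leqnSn n)) mI] := IH (ltnW nk).
have mZ : measurable_wrt (F n.+1) (fun w => t * stopped n w).
  apply: (measurable_wrtM (sF _) (measurable_wrt_cst (sF _) t)).
  exact: stopped_meas.
split.
  rewrite (_ : (fun _ => _) = fun w => complex.Re (stopped_prod n w) +
      (-1) * (t * stopped n w * complex.Im (stopped_prod n w))).
    apply: measurable_wrtD => //; apply: (measurable_wrtM (sF _) (measurable_wrt_cst (sF _) (-1))).
    exact: measurable_wrtM.
  by apply/funext => w; rewrite Re_stopped_prodS mulN1r.
rewrite (_ : (fun _ => _) = fun w => complex.Im (stopped_prod n w) +
    (t * stopped n w * complex.Re (stopped_prod n w))).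
  by apply: measurable_wrtD => //; exact: measurable_wrtM.
by apply/funext => w; rewrite Im_stopped_prodS.
Qed.

Lemma prod_stopped_le n w : \prod_(j < n) (1 + (t * stopped j w) ^+ 2) <=
  expR (t ^+ 2 * quad_var n w).
Proof.
rewrite /quad_var mulr_sumr expR_sum; apply: ler_prod => j _.
rewrite addr_ge0 ?sqr_ge0//=; apply: le_trans (expR_ge1Dx _) _.
by rewrite ler_expR exprMn ler_wpM2l ?sqr_ge0.
Qed.

(** Consider the last retained index: the squares before it sum to at most [c], so the earlier
    factors give at most [expR (t^2 * c)], and its own factor is at most [1 + t^2 * M]. Later
    factors equal 1. *)
Lemma prod_stopped_le_max n w : (n <= k)%N ->
  \prod_(j < n) (1 + (t * stopped j w) ^+ 2) <=
  expR (t ^+ 2 * c) * (1 + t ^+ 2 * M w).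
Proof.
have t2 := sqr_ge0 t.
have E1 : 1 <= expR (t ^+ 2 * c) by rewrite -expR0 ler_expR mulr_ge0.
have M1 : 1 <= 1 + t ^+ 2 * M w by rewrite lerDl mulr_ge0.
elim: n => [|n IH] nk.
  by rewrite big_ord0 -[leLHS]mulr1 ler_pM.
rewrite big_ord_recr /= {2}/stopped; case: ifPn => [Qc|_]; last first.
  by rewrite !mulr0 expr0n addr0 mulr1 IH// ltnW.
rewrite mulr1; apply: ler_pM.
- by apply: prodr_ge0 => j _; rewrite addr_ge0 ?sqr_ge0.
- by rewrite addr_ge0 ?sqr_ge0.
- by apply: le_trans (prod_stopped_le _ _) _; rewrite ler_expR ler_wpM2l.
- by rewrite lerD2l exprMn ler_wpM2l// Y_le_M.
Qed.

Lemma sum_stopped_sqr_le n w : (n <= k)%N ->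
  \sum_(j < n) stopped j w ^+ 2 <= c + M w.
Proof.
elim: n => [|n IH] nk; first by rewrite big_ord0 addr_ge0.
rewrite big_ord_recr /= {2}/stopped; case: ifPn => [Qc|_]; last first.
  by rewrite mulr0 expr0n addr0 IH// ltnW.
rewrite mulr1; apply: lerD; last exact: Y_le_M.
by apply: le_trans Qc; apply: ler_sum => j _; exact: stopped_le.
Qed.

Lemma Re_stopped_prod_sqr_le n w : (n <= k)%N ->
  complex.Re (stopped_prod n w) ^+ 2 + complex.Im (stopped_prod n w) ^+ 2 <=
  expR (t ^+ 2 * c) * (1 + t ^+ 2 * M w).
Proof. by move=> nk; rewrite norm_mcleish prod_stopped_le_max. Qed.

Let B := expR (t ^+ 2 * c).

(** Here no square overshoots, so the bound is deterministic. This is what makes the integrands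
    bounded in the martingale step. *)
Lemma stopped_prod_sqr_bound n w : quad_var n w <= c ->
  complex.Re (stopped_prod n w) ^+ 2 + complex.Im (stopped_prod n w) ^+ 2 <= B.
Proof.
move=> Qc; rewrite norm_mcleish; apply: le_trans (prod_stopped_le _ _) _.
by rewrite ler_expR ler_wpM2l ?sqr_ge0.
Qed.

Let norm_le_B (x : R) : x ^+ 2 <= B -> `|x| <= B.
Proof.
have B1 : 1 <= B by rewrite -expR0 ler_expR mulr_ge0 ?sqr_ge0.
have B0 : 0 <= B by rewrite (le_trans ler01).
move=> xB; rewrite -ler_sqr ?nnegrE// real_normK ?num_real//.
by rewrite (le_trans xB)// expr2 ler_peMr.
Qed.

Lemma stopped_prod_bound n w : quad_var n w <= c ->
  `|complex.Re (stopped_prod n w)| <= B /\ `|complex.Im (stopped_prod n w)| <= B.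
Proof.
move=> /stopped_prod_sqr_bound h.
split; apply: norm_le_B; apply: le_trans h; first by rewrite lerDl sqr_ge0.
by rewrite lerDr sqr_ge0.
Qed.

(** Each new factor adds [t * Y n] times the stopping indicator, a part of the product and [g].
    Grouping the indicator with the product gives an [F n]-measurable factor bounded by [B], against
    which [Y n] integrates to 0. *)
Lemma Rintegral_stopped_prod (g : T -> R) n : measurable_wrt (F 0) g ->
  (forall w, `|g w| <= 1) -> (n <= k)%N ->
  [/\ P.-integrable setT (EFin \o (fun w => complex.Re (stopped_prod n w) * g w)),
      P.-integrable setT (EFin \o (fun w => complex.Im (stopped_prod n w) * g w)),
      \int[P]_w (complex.Re (stopped_prod n w) * g w) = \int[P]_w g w &
      \int[P]_w (complex.Im (stopped_prod n w) * g w) = 0].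
Proof.
move=> mg g1.
have mgT := measurable_wrt_sub (sF 0) mg.
have gi := bounded_integrable P mgT g1.
elim: n => [|n IH] nk.
  have Re1 w : complex.Re (stopped_prod 0 w) * g w = g w.
    by rewrite /stopped_prod /mcleish big_ord0 mul1r.
  have Im0 w : complex.Im (stopped_prod 0 w) * g w = 0.
    by rewrite /stopped_prod /mcleish big_ord0 mul0r.
  rewrite (funext Re1) (funext Im0); split => //; last exact: Rintegral_prob_cst.
  by apply: (@bounded_integrable _ _ _ _ _ 0) => // w; rewrite normr0.
have [iR iI eR eI] := IH (ltnW nk).
have [mR mI] := stopped_prod_meas (ltnW nk).
have mQ := measurable_wrt_le_if (sF n) c 1 0 (quad_var_meas (ltnW nk)).
have key (f : T -> R) : measurable_wrt (F n) f ->
    (forall w, quad_var n w <= c -> `|f w| <= B) ->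
    P.-integrable setT (EFin \o (fun w => t * stopped n w * f w * g w)) /\
    \int[P]_w (t * stopped n w * f w * g w) = 0.
  move=> mf fB.
  pose f' w := f w * ((if quad_var n w <= c then 1 else 0) * g w).
  have mf' : measurable_wrt (F n) f'.
    apply: measurable_wrtM => //; apply: measurable_wrtM => //.
    exact: meas_le mg.
  have f'B w : `|f' w| <= B.
    rewrite /f'; case: ifPn => [/fB h|_]; last by rewrite mul0r mulr0 normr0 expR_ge0.
    by rewrite mul1r normrM -[leRHS]mulr1 ler_pM.
  have [h1 h2] := Rintegral_mul_centered (sF n) (Y_int nk) (Y_centered nk) mf' f'B.
  have E w : t * stopped n w * f w * g w = t * (Y n w * f' w).
    by rewrite /stopped /f'; ring.
  rewrite (funext E); split; first exact: integrable_EFinZ.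
  by rewrite RintegralZl// h2 mulr0.
have [kI kI0] := key _ mI (fun w h => (stopped_prod_bound h).2).
have [kR kR0] := key _ mR (fun w h => (stopped_prod_bound h).1).
have ER w : complex.Re (stopped_prod n.+1 w) * g w =
    complex.Re (stopped_prod n w) * g w - t * stopped n w * complex.Im (stopped_prod n w) * g w.
  by rewrite Re_stopped_prodS; ring.
have EI w : complex.Im (stopped_prod n.+1 w) * g w =
    complex.Im (stopped_prod n w) * g w + t * stopped n w * complex.Re (stopped_prod n w) * g w.
  by rewrite Im_stopped_prodS; ring.
rewrite (funext ER) (funext EI); split.
- exact: integrable_EFinB.
- exact: integrable_EFinD.
- by rewrite RintegralB// kI0 subr0.
- by rewrite RintegralD// kR0 addr0.
Qed.

Lemma stopped_sqr_integrable n : (n < k)%N ->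
  P.-integrable setT (EFin \o (fun w => stopped n w ^+ 2)).
Proof.
move=> nk; apply: le_integrable M_int => //.
  by apply/measurable_EFinP/measurable_funX/(measurable_wrt_sub (sF n.+1))/stopped_meas.
move=> w _ /=; rewrite lee_fin !ger0_norm ?sqr_ge0//.
by rewrite (le_trans (stopped_le _ _))// Y_le_M.
Qed.

Lemma Rintegral_stopped_sum_sqr n : (n <= k)%N ->
  [/\ P.-integrable setT (EFin \o (fun w => stopped_sum n w ^+ 2)),
      P.-integrable setT (EFin \o (fun w => \sum_(j < n) stopped j w ^+ 2)) &
      \int[P]_w (stopped_sum n w ^+ 2) =
      \int[P]_w (\sum_(j < n) stopped j w ^+ 2)].
Proof.
elim: n => [|n IH] nk.
  have E1 w : stopped_sum 0 w ^+ 2 = 0 by rewrite /stopped_sum big_ord0 expr0n.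
  have E2 w : \sum_(j < 0) stopped j w ^+ 2 = 0 by rewrite big_ord0.
  rewrite (funext E1) (funext E2); split => //;
  by apply: (@bounded_integrable _ _ _ _ _ 0) => // w; rewrite normr0.
have [i1 i2 e12] := IH (ltnW nk).
have mQ := measurable_wrt_le_if (sF n) c 1 0 (quad_var_meas (ltnW nk)).
pose f w := stopped_sum n w * (if quad_var n w <= c then 1 else 0).
have mf : measurable_wrt (F n) f.
  by apply: measurable_wrtM => //; exact: stopped_sum_meas (ltnW nk).
(* A crude bound from [|s| <= 1 + s^2]; its dependence on [n] is harmless, since boundedness only
   serves to make the cross term [E[Y n * f]] vanish. *)
have fB w : `|f w| <= n%:R + c.
  rewrite /f; case: ifPn => [Qc|_]; last by rewrite mulr0 normr0 addr_ge0.
  rewrite mulr1; apply: le_trans (ler_norm_sum _ _ _) _.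
  apply: (@le_trans _ _ (\sum_(j < n) (1 + Y j w ^+ 2))).
    apply: ler_sum => j _; have := stopped_le j w.
    rewrite -(real_normK (num_real (stopped j w))) => h.
    have : 0 <= (`|stopped j w| - 1) ^+ 2 by exact: sqr_ge0.
    have : 0 <= `|stopped j w| by [].
    nra.
  by rewrite big_split/= sumr_const card_ord lerD2l.
have [h1 h2] := Rintegral_mul_centered (sF n) (Y_int nk) (Y_centered nk) mf fB.
have E1 w : stopped_sum n.+1 w ^+ 2 =
    stopped_sum n w ^+ 2 + 2 * (Y n w * f w) + stopped n w ^+ 2.
  rewrite {1}/stopped_sum big_ord_recr/= -/(stopped_sum n w) /f /stopped; ring.
have E2 w : \sum_(j < n.+1) stopped j w ^+ 2 =
    \sum_(j < n) stopped j w ^+ 2 + stopped n w ^+ 2 by rewrite big_ord_recr.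
have si := stopped_sqr_integrable nk.
have hi := integrable_EFinZ 2 h1.
have i1h := integrable_EFinD i1 hi.
rewrite (funext E1) (funext E2); split; [exact: integrable_EFinD..|].
by rewrite !RintegralD// RintegralZl// h2 mulr0 addr0 e12.
Qed.

Variables (V : T -> R) (K : R).
Hypothesis V_meas : measurable_wrt (F 0) V.
Hypothesis V_ge0 : forall w, 0 <= V w.
(** The margin 1 absorbs [r]: off [Bad] and where [V <= K], the quadratic variation is at most
    [K + r <= c], so stopping does not act. *)
Hypothesis cK : c = K + 1.
Variables (Bad : set T) (r : R).
Hypothesis Bad_meas : measurable Bad.
Hypothesis r_ge0 : 0 <= r.
Hypothesis r_le1 : r <= 1.
Hypothesis tr_le1 : `|t| * r <= 1.
Hypothesis good : forall w, ~ Bad w ->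
  `|quad_var k w - V w| <= r /\ forall j, (j < k)%N -> `|Y j w| <= r.

Let S w := \sum_(j < k) Y j w.

Let VT : measurable_fun setT V. Proof. exact: measurable_wrt_sub (sF 0) V_meas. Qed.

Let E := [set w | K < `|V w|].

Let mE : measurable E. Proof. exact: measurable_norm_gt. Qed.

Let YT j : (j < k)%N -> measurable_fun setT (Y j).
Proof. by move=> jk; exact: measurable_wrt_sub (sF _) (Y_meas jk). Qed.

Let mS : measurable_fun setT S.
Proof.
rewrite (_ : S = fun w => \sum_(j < k) (fun (j : 'I_k) w => Y j w) j w)//.
by apply: measurable_sum => j; exact: YT.
Qed.

Let quad_var_good w : ~ Bad w -> ~ E w -> quad_var k w <= c.
Proof.
move=> /good[h1 _] /negP; rewrite /= -leNgt => h2.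
have := ler_norm (V w); move: h1 h2 r_le1; rewrite ler_norml cK; lra.
Qed.

Let stopped_good w j : ~ Bad w -> ~ E w -> (j < k)%N -> stopped j w = Y j w.
Proof.
move=> w1 w2 jk; rewrite /stopped ifT ?mulr1//.
exact: le_trans (quad_var_mono _ (ltnW jk)) (quad_var_good w1 w2).
Qed.

(** Off the two exceptional events the sum coincides with the stopped sum. By orthogonality of the
    increments, the latter has second moment at most [c + E[M]], and Chebyshev's inequality
    applies. *)
Lemma sum_tail (m : R) : 0 < m ->
  fine (P [set w | m < `|S w|]) <= fine (P E) + fine (P Bad) +
     (c + \int[P]_w M w) / m ^+ 2.
Proof.
move=> m0; have mA : measurable [set w | m < `|S w|] by exact: measurable_norm_gt.
have [i1 i2 e12] := Rintegral_stopped_sum_sqr (leqnn k).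
rewrite -(Rintegral_indic P mA).
have iA : P.-integrable setT (EFin \o (\1_[set w | m < `|S w|] : T -> R)).
  exact: integrable_indic.
apply: le_trans (@Rintegral_le_indic _ _ _ _ _ _ E Bad 0 1 (m ^+ 2)^-1 iA i1 mE Bad_meas _) _.
  move=> w; rewrite add0r mul1r.
  have S0 : 0 <= (m ^+ 2)^-1 * stopped_sum k w ^+ 2.
    by rewrite mulr_ge0 ?invr_ge0 ?sqr_ge0.
  have [Ew|nEw] := pselect (E w).
    rewrite ![\1_E _]indicE (mem_set Ew) indicE indicE.
    by case: (_ \in _); case: (_ \in _) => /=; lra.
  have [Bw|nBw] := pselect (Bad w).
    rewrite ![\1_Bad _]indicE (mem_set Bw) indicE indicE.
    by case: (_ \in _); case: (_ \in _) => /=; lra.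
  rewrite [\1_E _]indicE [\1_Bad _]indicE (memNset nEw) (memNset nBw) indicE /= !add0r.
  case: (boolP (_ \in _)) => [/set_mem/= mw|_] //=.
  rewrite ler_pdivlMl ?exprn_gt0// mulr1.
  have -> : stopped_sum k w = S w.
    by apply: eq_bigr => j _; exact: stopped_good.
  rewrite -(real_normK (num_real (S w))) ler_sqr ?nnegrE//; first exact: ltW.
  exact: ltW.
rewrite add0r mul1r lerD2l mulrC e12 ler_wpM2r ?invr_ge0 ?sqr_ge0//.
apply: (@le_trans _ _ (\int[P]_w (c + M w))).
  have ci : P.-integrable setT (EFin \o (fun _ : T => c)).
    by apply: (@bounded_integrable _ _ _ _ _ `|c|) => //; exact: measurable_cst.
  apply: le_Rintegral => //; first exact: integrable_EFinD.
  by move=> w _; exact: sum_stopped_sqr_le.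
rewrite RintegralD ?Rintegral_prob_cst//.
by apply: (@bounded_integrable _ _ _ _ _ `|c|) => //; exact: measurable_cst.
Qed.

(** Cutting at [V <= K] removes the stopped product exactly where stopping could make it differ from
    the original one, and keeps [g] measurable for [F 0]. *)
Let g w : R := if V w <= K then expR (- (V w * t ^+ 2) / 2) else 0.

Let g_meas : measurable_wrt (F 0) g.
Proof.
rewrite (_ : g = fun w => ((fun x => expR (- (x * t ^+ 2) / 2)) \o V) w *
    (if V w <= K then 1 else 0)); last first.
  by apply/funext => w; rewrite /g /=; case: ifP; rewrite ?mulr1 ?mulr0.
apply: measurable_wrtM => //; last exact: measurable_wrt_le_if.
apply: measurable_wrt_comp => //.
apply: measurableT_comp => //; apply: measurable_funM => //.
by apply: measurable_funN; exact: measurable_funM.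
Qed.

Let g01 w : 0 <= g w <= 1.
Proof.
rewrite /g; case: ifP => _; last by rewrite lexx ler01.
rewrite expR_ge0 expR_le1 mulNr oppr_le0.
by rewrite divr_ge0// mulr_ge0 ?sqr_ge0.
Qed.

(** The first term is the error of [mcleish_approx] at scale [|t| * r]; the second comes from
    replacing the quadratic variation by [V] in the exponential. Both are divided by [r]. *)
Let C1 := 2 * `|t| * t ^+ 2 * c + B * t ^+ 2 / 2.

Lemma g_approx :
  `|\int[P]_w g w - \int[P]_w expR (- (V w * t ^+ 2) / 2)| <= fine (P E).
Proof.
have mgT : measurable_fun setT g by exact: measurable_wrt_sub (sF 0) g_meas.
have gi : P.-integrable setT (EFin \o g).
  apply: (@bounded_integrable _ _ _ _ _ 1) => // w.
  by have /andP[g0 g1] := g01 w; rewrite ger0_norm.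
have e01 w : 0 <= expR (- (V w * t ^+ 2) / 2) <= 1.
  by rewrite expR_ge0 expR_le1 mulNr oppr_le0 divr_ge0// mulr_ge0 ?sqr_ge0.
have ei : P.-integrable setT (EFin \o (fun w => expR (- (V w * t ^+ 2) / 2))).
  apply: (@bounded_integrable _ _ _ _ _ 1) => [|w].
    apply: measurableT_comp => //; apply: measurable_funM => //.
    by apply: measurable_funN; exact: measurable_funM.
  by have /andP[e0 e1] := e01 w; rewrite ger0_norm.
rewrite -[leRHS]add0r -[fine _]mul1r; apply: ler_dist_Rintegral => // w.
  move/negP; rewrite -leNgt ger0_norm// => VK.
  by rewrite /g VK subrr normr0.
move=> _; rewrite /g; case: ifP => _; first by rewrite subrr normr0 add0r.
rewrite sub0r normrN add0r.
by have /andP[e0 e1] := e01 w; rewrite ger0_norm.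
Qed.

(* [cs] is [cos] or [sin], and [part] is the real or the imaginary part. *)
Lemma charfun_approx (cs : R -> R) (part : R[i] -> R) (a : R) :
  continuous cs -> (forall x, `|cs x| <= 1) ->
  (forall z, part z ^+ 2 <= complex.Re z ^+ 2 + complex.Im z ^+ 2) ->
  (forall z (x y e : R),
    `|z * x%:C%C - cis y| <= e%:C%C -> `|part z * x - cs y| <= e) ->
  0 < a ->
  P.-integrable setT (EFin \o (fun w => part (stopped_prod k w) * g w)) ->
  `|\int[P]_w cs (t * S w) - \int[P]_w (part (stopped_prod k w) * g w)| <=
  (C1 * r + a / 2 * B) + fine (P E) + (1 + (2 * a)^-1) * fine (P Bad) +
    (a / 2 * B * t ^+ 2) * \int[P]_w M w.
Proof.
move=> cs_cont cs_le1 part_sqr part_approx a0 pgi.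
have mcs : measurable_fun setT (fun w => cs (t * S w)).
  have mtS : measurable_fun setT (fun w => t * S w) by exact: measurable_funM.
  exact: (measurableT_comp (continuous_measurable_fun cs_cont) mtS).
have csi := bounded_integrable P mcs (fun w => cs_le1 (t * S w)).
have di := integrable_EFinB csi pgi.
rewrite -RintegralB//; apply: le_trans (le_normr_Rintegral measurableT di) _.
apply: Rintegral_le_indic => //; first exact: (integrable_norm di).
move=> w.
have B0 : 0 <= B by exact: expR_ge0.
have t2 := sqr_ge0 t.
have C10 : 0 <= C1.
  rewrite /C1; apply: addr_ge0; last by rewrite divr_ge0// mulr_ge0.
  apply: (mulr_ge0 _ c_ge0); apply: (mulr_ge0 _ t2); exact: mulr_ge0.
have psqr : part (stopped_prod k w) ^+ 2 <= B * (1 + t ^+ 2 * M w).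
  by apply: le_trans (part_sqr _) _; exact: Re_stopped_prod_sqr_le.
have BtM : 0 <= B * (1 + t ^+ 2 * M w) by rewrite mulr_ge0// addr_ge0// mulr_ge0.
have aBtM : 0 <= a / 2 * (B * (1 + t ^+ 2 * M w)) by rewrite mulr_ge0// divr_ge0// ltW.
have a20 : 0 <= (2 * a)^-1 by rewrite invr_ge0 mulr_ge0// ltW.
have -> : C1 * r + a / 2 * B + \1_E w + (1 + (2 * a)^-1) * \1_Bad w +
    a / 2 * B * t ^+ 2 * M w = C1 * r + \1_E w + (1 + (2 * a)^-1) * \1_Bad w +
    a / 2 * (B * (1 + t ^+ 2 * M w)) by ring.
rewrite /=; move: psqr BtM aBtM; set W := B * (1 + t ^+ 2 * M w) => psqr BtM aBtM.
have C1r : 0 <= C1 * r by rewrite mulr_ge0.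
have /andP[g0 g1] := g01 w; have cs1 := cs_le1 (t * S w).
have IE : 0 <= (\1_E w : R) by rewrite indicE.
have IB : 0 <= (1 + (2 * a)^-1) * \1_Bad w by rewrite mulr_ge0 ?indicE// addr_ge0.
have [Bw|nBw] := pselect (Bad w).
  rewrite (le_trans (ler_normB _ _))// normrM (ger0_norm g0).
  set p := part _ in psqr *.
  have pg : `|p| * g w <= `|p| by rewrite ler_piMr.
  (* Young's inequality: the first term has an expectation proportional to [a] whatever the bad
     event is, while the second is multiplied by the probability of [Bad]. *)
  have ap : `|p| <= a / 2 * W + (2 * a)^-1.
    apply: (@le_trans _ _ (a / 2 * p ^+ 2 + (2 * a)^-1)); last first.
      by rewrite lerD2r ler_wpM2l// divr_ge0// ltW.
    have := sqr_ge0 (a * `|p| - 1).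
    rewrite sqrrB expr1n mulr1 exprMn real_normK ?num_real// => h.
    rewrite -(ler_pM2l (mulr_gt0 (ltr0n R 2) a0)) mulrDr mulfV ?gt_eqF ?mulr_gt0//.
    have -> : 2 * a * (a / 2 * p ^+ 2) = a ^+ 2 * p ^+ 2 by field.
    by move: h; rewrite mulr2n; lra.
  rewrite [\1_Bad _]indicE (mem_set Bw) mulr1; move: IE; lra.
(* On [E] the truncation leaves only [|cs| <= 1], charged to the indicator of [E]. *)
have [Ew|nEw] := pselect (E w).
  have -> : g w = 0.
    rewrite /g ifF//; apply/negP => /le_lt_trans VK.
    by move: Ew; rewrite /E/= ger0_norm// => KV; have := VK _ KV; rewrite ltxx.
  rewrite mulr0 subr0 [\1_E _]indicE (mem_set Ew) /=; move: cs1 IB C1r aBtM; lra.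
apply: (@le_trans _ _ (C1 * r)); last by move: IE IB aBtM; lra.
have gE : g w = expR (- (V w * t ^+ 2 / 2)).
  rewrite /g mulNr ifT//; move/negP: nEw; rewrite /E /= -leNgt.
  exact: le_trans (ler_norm _).
have Qc := quad_var_good nBw nEw.
have [QV Yr] := good nBw.
have sY j : (j < k)%N -> stopped j w = Y j w by exact: stopped_good.
have ES : \sum_(j < k) t * stopped j w = t * S w.
  by rewrite /S mulr_sumr; apply: eq_bigr => j _; rewrite sY.
have EQ : \sum_(j < k) (t * stopped j w) ^+ 2 = t ^+ 2 * quad_var k w.
  by rewrite /quad_var mulr_sumr; apply: eq_bigr => j _; rewrite sY// exprMn.
have := @mcleish_approx R k (fun j => t * stopped j w) (`|t| * r) tr_le1 _.
rewrite ES EQ => /(_ _)/part_approx h.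
have {}h : `|part (stopped_prod k w) * expR (- (t ^+ 2 * quad_var k w) / 2) -
    cs (t * S w)| <= 2 * (`|t| * r) * (t ^+ 2 * quad_var k w).
  by apply: h => j jk; rewrite sY// normrM ler_wpM2l// Yr.
set p := part _ in psqr h *.
set q := expR _ in h.
have pB : `|p| <= B.
  by apply: norm_le_B; apply: le_trans (part_sqr _) _; exact: stopped_prod_sqr_bound.
have qg : `|q - g w| <= t ^+ 2 * r / 2.
  rewrite gE /q mulNr; apply: le_trans (ler_dist_expRN _ _) _.
  - by rewrite divr_ge0// mulr_ge0// sumr_ge0// => j _; exact: sqr_ge0.
  - by rewrite divr_ge0// mulr_ge0.
  rewrite [V w * _]mulrC -mulrBl -mulrBr normrM [`|2^-1|]ger0_norm ?invr_ge0//.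
  by rewrite ler_pM2r ?invr_gt0// normrM (ger0_norm t2) ler_wpM2l.
have -> : cs (t * S w) - p * g w = p * (q - g w) - (p * q - cs (t * S w)) by ring.
rewrite (le_trans (ler_normB _ _))// normrM.
have -> : C1 * r = B * (t ^+ 2 * r / 2) + 2 * (`|t| * r) * (t ^+ 2 * c).
  by rewrite /C1; field.
apply: lerD; first exact: ler_pM.
apply: le_trans h _; rewrite ler_wpM2l ?mulr_ge0//.
by rewrite ler_wpM2l.
Qed.

Let gN1 w : `|g w| <= 1.
Proof. by have /andP[g0 g1] := g01 w; rewrite ger0_norm. Qed.

(** [P E] is counted twice: once where [g] vanishes and once for undoing the truncation. The sine
    below has it once, since [E[Im T * g] = 0] leaves nothing to untruncate. *)
Lemma cos_approx (a : R) : 0 < a ->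
  `|\int[P]_w cos (t * S w) - \int[P]_w expR (- (V w * t ^+ 2) / 2)| <=
  (C1 * r + a / 2 * B) + 2 * fine (P E) + (1 + (2 * a)^-1) * fine (P Bad) +
    (a / 2 * B * t ^+ 2) * \int[P]_w M w.
Proof.
move=> a0; have [iR _ eR _] := Rintegral_stopped_prod g_meas gN1 (leqnn k).
have cosR z (x y e : R) : `|z * x%:C%C - cis y| <= e%:C%C ->
    `|complex.Re z * x - cos y| <= e.
  case: z => u v /(le_trans (normc_ge_Re _)); rewrite lecR /=.
  by rewrite mulr0 subr0.
have ReE (z : R[i]) : complex.Re z ^+ 2 <= complex.Re z ^+ 2 + complex.Im z ^+ 2.
  by rewrite lerDl sqr_ge0.
have := charfun_approx (@continuous_cos R) (@cos_max R) ReE cosR a0 iR.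
have := g_approx; rewrite eR.
set x := \int[P]_w cos _; set y := \int[P]_w g _; set z := \int[P]_w expR _.
move=> h1 h2; have -> : x - z = (x - y) + (y - z) by ring.
apply: le_trans (ler_normD _ _) _; move: h1 h2; lra.
Qed.

Lemma sin_approx (a : R) : 0 < a ->
  `|\int[P]_w sin (t * S w)| <=
  (C1 * r + a / 2 * B) + fine (P E) + (1 + (2 * a)^-1) * fine (P Bad) +
    (a / 2 * B * t ^+ 2) * \int[P]_w M w.
Proof.
move=> a0; have [_ iI _ eI] := Rintegral_stopped_prod g_meas gN1 (leqnn k).
have sinI z (x y e : R) : `|z * x%:C%C - cis y| <= e%:C%C ->
    `|complex.Im z * x - sin y| <= e.
  case: z => u v /(le_trans (normc_ge_Im _)); rewrite lecR /=.
  by rewrite mulr0 add0r.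
have ImE (z : R[i]) : complex.Im z ^+ 2 <= complex.Re z ^+ 2 + complex.Im z ^+ 2.
  by rewrite lerDr sqr_ge0.
have := charfun_approx (@continuous_sin R) (@sin_max R) ImE sinI a0 iI.
by rewrite eI subr0.
Qed.

End StoppedMartingale.

(** * Arrays of martingale differences *)

Section MartingaleCLT.
Context (R : realType) (d : nat -> measure_display)
  (Omega : forall n, measurableType (d n))
  (P : forall n, probability (Omega n) R)
  (k : nat -> nat) (F : forall n, nat -> set (set (Omega n)))
  (X : forall n, nat -> {RV (P n) >-> R}).
Arguments F : clear implicits.
Arguments X : clear implicits.
Hypothesis F_filtration : forall n, filtration (F n).
Hypothesis X_mart_diff : forall n j, (1 <= j <= k n)%N ->
  martingale_difference (P n) (F n) (X n) j.

Let maxabs n w : R := \big[Num.max/0]_(1 <= i < (k n).+1) `|X n i w|.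
Let maxsqr n w : R := \big[Num.max/0]_(1 <= j < (k n).+1) X n j w ^+ 2.
Arguments maxabs : clear implicits.
Arguments maxsqr : clear implicits.

Hypothesis hi : cvg0_in_probability P maxabs.
Variable L : R.
Hypothesis hii : forall n, ('E_(P n)[maxsqr n] <= L%:E)%E.
Variable eta2 : forall n, {RV (P n) >-> R}.
Arguments eta2 : clear implicits.
Hypothesis eta2_ge0 : forall n w, 0 <= eta2 n w.
Hypothesis eta2_meas : forall n, measurable_wrt (F n 0%N) (eta2 n).
Hypothesis hiii : cvg0_in_probability P
  (fun n w => \sum_(1 <= j < (k n).+1) X n j w ^+ 2 - eta2 n w).
Context (d' : measure_display) (Omega' : measurableType d')
  (P' : probability Omega' R) (eta2_lim : {RV P' >-> R}).
Hypothesis eta2_lim_ge0 : forall w, 0 <= eta2_lim w.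
Hypothesis hiv : cvg_in_distribution P eta2 (distribution P' eta2_lim).

Let Y n j : Omega n -> R := X n j.+1.
Arguments Y : clear implicits.
Let S n w := \sum_(j < k n) Y n j w.
Arguments S : clear implicits.

Let sumE n (f : R -> R) w :
  \sum_(1 <= j < (k n).+1) f (X n j w) = \sum_(j < k n) f (Y n j w).
Proof. by rewrite big_add1 big_mkord. Qed.

Let Yj n j : (j < k n)%N -> martingale_difference (P n) (F n) (X n) j.+1.
Proof. by move=> jk; apply: X_mart_diff. Qed.

Let Y_meas n j : (j < k n)%N -> measurable_wrt (F n j.+1) (Y n j).
Proof. by case/Yj. Qed.

Let Y_int n j : (j < k n)%N -> (P n).-integrable setT (EFin \o Y n j).
Proof. by case/Yj. Qed.

Let Y_centered n j : (j < k n)%N ->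
  is_cond_expectation (P n) (F n j) (Y n j) (cst 0).
Proof. by case/Yj. Qed.

Let maxabs_meas n : measurable_fun setT (maxabs n).
Proof. by apply: measurable_bigmax => j; exact: measurableT_comp. Qed.

Let maxsqr_meas n : measurable_fun setT (maxsqr n).
Proof. by apply: measurable_bigmax => j; exact: measurable_funX. Qed.

Let maxsqr_ge0 n w : 0 <= maxsqr n w.
Proof. exact: bigmax_ge_id. Qed.

Let index_mem n j : (j < k n)%N -> j.+1 \in index_iota 1 (k n).+1.
Proof. by move=> jk; rewrite mem_index_iota. Qed.

Let Y_le_maxsqr n j w : (j < k n)%N -> Y n j w ^+ 2 <= maxsqr n w.
Proof.
move=> /index_mem jk.
exact: (@le_bigmax_seq _ _ _ _ 0 j.+1 xpredT (fun i => X n i w ^+ 2) jk isT).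
Qed.

Let Y_le_maxabs n j w : (j < k n)%N -> `|Y n j w| <= maxabs n w.
Proof.
move=> /index_mem jk.
exact: (@le_bigmax_seq _ _ _ _ 0 j.+1 xpredT (fun i => `|X n i w|) jk isT).
Qed.

Let maxsqr_int n : (P n).-integrable setT (EFin \o maxsqr n).
Proof.
apply/integrableP; split; first exact/measurable_EFinP.
under eq_integral do rewrite /= ger0_norm//.
by apply: le_lt_trans (ltry L); have := hii n; rewrite unlock.
Qed.

Let maxsqr_le n : \int[P n]_w maxsqr n w <= L.
Proof.
rewrite -lee_fin /Rintegral fineK; last exact: integrable_fin_num (maxsqr_int n).
by have := hii n; rewrite unlock.
Qed.

Let Bad n (r : R) : set (Omega n) := [set w | r <= `|maxabs n w|] `|`
  [set w | r <= `|\sum_(1 <= j < (k n).+1) X n j w ^+ 2 - eta2 n w|].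
Arguments Bad : clear implicits.

Let Q_meas n : measurable_fun setT
  (fun w => \sum_(1 <= j < (k n).+1) X n j w ^+ 2 - eta2 n w).
Proof.
apply: measurable_funB => //; apply: measurable_sum => j.
exact: measurable_funX.
Qed.

Let Bad_meas n r : measurable (Bad n r).
Proof. by apply: measurableU; exact: measurable_norm_ge. Qed.

Let good n r w : ~ Bad n r w ->
  `|quad_var (Y n) (k n) w - eta2 n w| <= r /\
  forall j, (j < k n)%N -> `|Y n j w| <= r.
Proof.
move=> nB; split.
  rewrite /quad_var -(sumE (fun x => x ^+ 2)) leNgt; apply/negP => /ltW h.
  by apply: nB; right.
move=> j jk; apply: (le_trans (Y_le_maxabs w jk)).
rewrite leNgt; apply/negP => /ltW h; apply: nB; left => /=.
exact: le_trans h (ler_norm _).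
Qed.

Let Bad_small (r e : R) : 0 < r -> 0 < e ->
  \forall n \near \oo, fine (P n (Bad n r)) <= e.
Proof.
move=> r0 e0; have e2 := divr_gt0 e0 (ltr0n R 2).
have /fine_cvgP[_ /cvgrPdist_le/(_ _ e2)] := hi r0.
have /fine_cvgP[_ /cvgrPdist_le/(_ _ e2)] := hiii r0.
apply: filterS2 => n /=; rewrite !sub0r !normrN => h2 h1.
have fP A : measurable A -> P n A \is a fin_num by move=> mA; exact: fin_num_measure.
have m1 : measurable [set w | r <= `|maxabs n w|] by exact: measurable_norm_ge.
have m2 : measurable [set w | r <= `|\sum_(1 <= j < (k n).+1) X n j w ^+ 2 - eta2 n w|].
  exact: measurable_norm_ge.
move: h1 h2; set A1 := [set w | _] in m1 *; set A2 := [set w | _] in m2 * => h1 h2.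
apply: (@le_trans _ _ (fine (P n A1) + fine (P n A2))); last first.
  by move: (le_trans (ler_norm _) h1) (le_trans (ler_norm _) h2); lra.
have mB : measurable (A1 `|` A2) by exact: measurableU.
rewrite -lee_fin EFinD !fineK ?fP//.
exact: measureU2.
Qed.

Let L_ge0 : 0 <= L.
Proof. apply: (@le_trans _ _ (\int[P 0%N]_w maxsqr 0%N w)); last exact: maxsqr_le.
by apply: Rintegral_ge0 => w _; exact: maxsqr_ge0. Qed.

Let eta2_tight (e : R) : 0 < e -> exists2 K : R, 0 <= K &
  \forall n \near \oo, fine (P n [set w | K < `|eta2 n w|]) <= e.
Proof.
by have meta n : measurable_fun setT (eta2 n) by []; exact: (cvg_in_distribution_tight meta hiv).
Qed.

Let S_tight (e : R) : 0 < e -> exists m : R,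
  \forall n \near \oo, fine (P n [set w | m < `|S n w|]) <= e.
Proof.
move=> e0; have e3 := divr_gt0 e0 (ltr0n R 3).
have [K K0 hK] := eta2_tight e3.
(* Since [m >= 1], the Chebyshev term is at most [(K + 1 + L) / m <= e / 3]; the other two thirds go
   to the exceptional events. *)
pose m := (K + 1 + L) / (e / 3) + 1.
have m1 : 1 <= m by rewrite lerDr divr_ge0 ?addr_ge0// ltW.
exists m; near=> n.
have hE : fine (P n [set w | K < `|eta2 n w|]) <= e / 3 by near: n.
have hB : fine (P n (Bad n 1)) <= e / 3 by near: n; exact: Bad_small.
have c0 : 0 <= K + 1 by rewrite addr_ge0.
have m0 : 0 < m by exact: lt_le_trans m1.
have h := sum_tail (F_filtration n) (@Y_meas n) (@Y_int n) (@Y_centered n)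
  (maxsqr_int n) (@maxsqr_ge0 n) (@Y_le_maxsqr n) c0 (@eta2_meas n)
  (erefl (K + 1)) (Bad_meas n 1) (lexx 1) (@good n 1) m0.
have hm : (K + 1 + \int[P n]_w maxsqr n w) / m ^+ 2 <= e / 3.
  rewrite ler_pdivrMr ?exprn_gt0//.
  apply: (@le_trans _ _ (K + 1 + L)); first by rewrite lerD2l.
  apply: (@le_trans _ _ (e / 3 * m)).
    rewrite /m mulrDr mulrCA mulfV ?gt_eqF// !mulr1 lerDl ltW//.
  by rewrite ler_pM2l// expr2 ler_peMr// ltW.
by apply: le_trans h _; move: hE hB hm; lra.
Unshelve. all: by end_near. Qed.

(** Carries out the choice of constants once for cosine and sine. The shares are [e/4] for the term
    in [r], [e/4] for the two terms in [a], [e/4] for the escape of [eta2] above [K], and [e/8] for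
    [Bad]. *)
Let integral_approx (t : R) (f : forall n, R) (e : R) : 0 < e ->
  (forall n (K r a : R), 0 <= K -> 0 < r -> r <= 1 -> `|t| * r <= 1 -> 0 < a ->
    `|f n| <= ((2 * `|t| * t ^+ 2 * (K + 1) + expR (t ^+ 2 * (K + 1)) * t ^+ 2 / 2) * r +
      a / 2 * expR (t ^+ 2 * (K + 1))) + 2 * fine (P n [set w | K < `|eta2 n w|]) +
      (1 + (2 * a)^-1) * fine (P n (Bad n r)) +
      (a / 2 * expR (t ^+ 2 * (K + 1)) * t ^+ 2) * \int[P n]_w maxsqr n w) ->
  \forall n \near \oo, `|f n| <= e.
Proof.
move=> e0 bnd.
have e8 : 0 < e / 8 by exact: divr_gt0.
have [K K0 hK] := eta2_tight e8.
have c0 : 0 <= K + 1 by rewrite addr_ge0.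
have t2 := sqr_ge0 t.
pose B := expR (t ^+ 2 * (K + 1)); have B0 : 0 < B by exact: expR_gt0.
pose C1 := 2 * `|t| * t ^+ 2 * (K + 1) + B * t ^+ 2 / 2.
have C10 : 0 <= C1.
  rewrite /C1; apply: addr_ge0; last by rewrite divr_ge0// mulr_ge0// ltW.
  apply: (mulr_ge0 _ c0); apply: (mulr_ge0 _ t2); exact: mulr_ge0.
have tL : 0 < 1 + t ^+ 2 * L by rewrite ltr_pwDl// mulr_ge0.
pose a := e / (2 * (B * (1 + t ^+ 2 * L))).
have a0 : 0 < a by rewrite divr_gt0// !mulr_gt0.
(* The three summands make [r = 1/D] satisfy [r <= 1], [|t| * r <= 1] and [C1 * r <= e/4]
   respectively. *)
pose D := 1 + `|t| + 4 * C1 / e.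
have C1e : 0 <= 4 * C1 / e by rewrite divr_ge0 ?mulr_ge0// ltW.
have D0 : 0 < D by rewrite /D -addrA ltr_pwDl// addr_ge0.
pose r := D^-1; have r0 : 0 < r by rewrite invr_gt0.
have r1 : r <= 1.
  by rewrite invf_le1// /D -addrA lerDl addr_ge0.
have tr : `|t| * r <= 1.
  by rewrite ler_pdivrMr// mul1r /D; move: C1e; lra.
have Cr : C1 * r <= e / 4.
  rewrite ler_pdivrMr// /D; have -> : e / 4 * (1 + `|t| + 4 * C1 / e) =
    e / 4 + e / 4 * `|t| + C1 by field; rewrite gt_eqF.
  have e4 : 0 <= e / 4 by rewrite divr_ge0// ltW.
  by rewrite lerDr; apply: addr_ge0 => //; exact: mulr_ge0.
have b0 : 0 < 1 + (2 * a)^-1 by rewrite addr_gt0// invr_gt0 mulr_gt0.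
near=> n.
have hE : fine (P n [set w | K < `|eta2 n w|]) <= e / 8 by near: n.
have hB : fine (P n (Bad n r)) <= e / 8 / (1 + (2 * a)^-1).
  by near: n; apply: Bad_small => //; exact: divr_gt0.
apply: le_trans (bnd n K r a K0 r0 r1 tr a0) _; rewrite -/B -/C1.
have {}hB : (1 + (2 * a)^-1) * fine (P n (Bad n r)) <= e / 8.
  by rewrite mulrC -ler_pdivlMr.
have hM : a / 2 * B * t ^+ 2 * \int[P n]_w maxsqr n w <= a / 2 * B * t ^+ 2 * L.
  apply: ler_wpM2l (maxsqr_le n).
  exact: (mulr_ge0 (mulr_ge0 (divr_ge0 (ltW a0) (ler0n _ 2)) (ltW B0)) t2).
have aE : a / 2 * B + a / 2 * B * t ^+ 2 * L = e / 4.
  by rewrite /a; field; rewrite !gt_eqF.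
move: hE hB hM aE Cr; lra.
Unshelve. all: by end_near. Qed.

Let P_ge0 n A : 0 <= fine (P n A). Proof. exact: fine_ge0. Qed.

Let cvg_cos (t : R) :
  (fun n => \int[P n]_w cos (t * S n w)) @ \oo -->
  \int[gaussian_mixture eta2_lim]_x cos (t * x).
Proof.
rewrite cos_gaussian_mixture//.
(* The exponential is unbounded on the negative axis; the maximum with 0 makes it an admissible test
   function without changing it at the values of [eta2]. *)
pose f (x : R) := expR (Num.max x 0 * (- t ^+ 2 / 2)).
have fE x : 0 <= x -> f x = expR (- (x * t ^+ 2) / 2).
  by move=> x0; rewrite /f max_l//; congr expR; ring.
have f01 x : 0 <= f x <= 1.
  rewrite expR_ge0 expR_le1 mulNr mulrN oppr_le0 mulr_ge0 ?le_max ?lexx ?orbT//.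
  by rewrite divr_ge0 ?sqr_ge0.
have cf : continuous f.
  move=> x; have c1 : {for x, continuous (fun y : R => Num.max y 0 * (- t ^+ 2 / 2))}.
    apply: cvgM; last exact: cvg_cst.
    by apply: continuous_max; [exact: cvg_id|exact: cvg_cst].
  exact: (continuous_comp c1 (@continuous_expR R _)).
have bf : bounded_fun f.
  exists 1; split; first by rewrite num_real.
  move=> M M1 x _; have /andP[f0 f1] := f01 x.
  by rewrite /= ger0_norm// (le_trans f1)// ltW.
have E n : \int[P n]_w f (eta2 n w) = \int[P n]_w expR (- (eta2 n w * t ^+ 2) / 2).
  by apply: eq_Rintegral => w _; rewrite fE.
have := hiv cf bf; rewrite (funext E).
have -> : \int[distribution P' eta2_lim]_x f x =
    \int[P']_w expR (- (eta2_lim w * t ^+ 2) / 2).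
  have mf : measurable_fun setT f by exact: continuous_measurable_fun.
  rewrite /Rintegral integral_distribution//; last 2 first.
  - exact/measurable_EFinP.
  - apply: (@bounded_integrable _ _ _ P' (f \o eta2_lim) 1) => [|w].
      exact: measurableT_comp.
    by have /andP[f0 f1] := f01 (eta2_lim w); rewrite ger0_norm.
  by congr fine; apply: eq_integral => w _; rewrite /= fE.
move=> hf.
suff h : (fun n => \int[P n]_w cos (t * S n w) -
    \int[P n]_w expR (- (eta2 n w * t ^+ 2) / 2)) @ \oo --> (0 : R).
  rewrite -[X in _ --> X]add0r [X in X @ _ --> _](_ : _ = (fun n =>
      (\int[P n]_w cos (t * S n w) - \int[P n]_w expR (- (eta2 n w * t ^+ 2) / 2)) +
      \int[P n]_w expR (- (eta2 n w * t ^+ 2) / 2))); first exact: cvgD.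
  by apply/funext => n; rewrite subrK.
apply/cvgr0Pnorm_le => e e0.
apply: (integral_approx (t := t) e0) => n K r a K0 r0 r1 tr a0.
have c0 : 0 <= K + 1 by rewrite addr_ge0.
exact: (cos_approx (F_filtration n) (@Y_meas n) (@Y_int n) (@Y_centered n)
  (maxsqr_int n) (@maxsqr_ge0 n) (@Y_le_maxsqr n) c0 (@eta2_meas n) (@eta2_ge0 n)
  (erefl (K + 1)) (Bad_meas n r) (ltW r0) r1 tr (@good n r) a0).
Qed.

Let cvg_sin (t : R) :
  (fun n => \int[P n]_w sin (t * S n w)) @ \oo -->
  \int[gaussian_mixture eta2_lim]_x sin (t * x).
Proof.
rewrite sin_gaussian_mixture//.
apply/cvgr0Pnorm_le => e e0.
apply: (integral_approx (t := t) e0) => n K r a K0 r0 r1 tr a0.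
have c0 : 0 <= K + 1 by rewrite addr_ge0.
have := (sin_approx (F_filtration n) (@Y_meas n) (@Y_int n) (@Y_centered n)
  (maxsqr_int n) (@maxsqr_ge0 n) (@Y_le_maxsqr n) c0 (@eta2_meas n) (@eta2_ge0 n)
  (erefl (K + 1)) (Bad_meas n r) (ltW r0) r1 tr (@good n r) a0).
move=> /le_trans; apply; rewrite !lerD2r lerD2l.
by rewrite ler_peMl// ler1n.
Qed.

Lemma martingale_clt_F0 : cvg_in_distribution P
  (fun n w => \sum_(1 <= j < (k n).+1) X n j w) (gaussian_mixture eta2_lim).
Proof.
have SE n w : \sum_(1 <= j < (k n).+1) X n j w = S n w by exact: (sumE id).
move=> f cf bf; have -> : (fun n => \int[P n]_w f (\sum_(1 <= j < (k n).+1) X n j w)) =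
    (fun n => \int[P n]_w f (S n w)).
  by apply/funext => n; apply: eq_Rintegral => w _; rewrite SE.
apply: (cvg_in_distribution_charfun _ cvg_cos cvg_sin S_tight) => // n.
rewrite (_ : S n = fun w => \sum_(j < k n) (fun (j : 'I_(k n)) w => Y n j w) j w)//.
exact: measurable_sum.
Qed.

End MartingaleCLT.

(** * The stationary case, by a measure preserving shift *)

Section MeasurePreserving.
Context d (T : measurableType d) (R : realType) (P : probability T R).
Variable f : T -> T.
Hypothesis fP : measure_preserving P f.

Lemma measure_preserving_iter n : measure_preserving P (iter n f).
Proof.
elim: n => [|n [mI PI]]; first by split; [exact: measurable_id|].
split; first exact: measurableT_comp fP.1 mI.
move=> A mA; rewrite -(fP.2 A mA) -(PI (f @^-1` A))//.
by rewrite -[X in measurable X]setTI; exact: fP.1.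
Qed.

Lemma measure_preserving_ge0_integral (g : T -> \bar R) :
  measurable_fun setT g -> (forall w, 0 <= g w)%E ->
  (\int[P]_w g (f w) = \int[P]_w g w)%E.
Proof.
move=> mg g0; rewrite -(@ge0_integral_pushforward _ _ _ _ _ f fP.1 P setT g)//.
by apply: eq_measure_integral; [exact: fP.1|move=> ? A mA _; exact: fP.2].
Qed.

Lemma measure_preserving_Rintegral (g : T -> R) (B : R) :
  measurable_fun setT g -> (forall w, `|g w| <= B) ->
  \int[P]_w g (f w) = \int[P]_w g w.
Proof.
move=> mg gB; rewrite /Rintegral; congr fine.
have mgf : measurable_fun setT (g \o f) by exact: measurableT_comp fP.1.
have igf := bounded_integrable P mgf (fun w => gB (f w)).
rewrite -(@integral_pushforward _ _ _ _ _ f fP.1 P setT (EFin \o g))//; last exact/measurable_EFinP.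
by apply: eq_measure_integral; [exact: fP.1|move=> ? A mA _; exact: fP.2].
Qed.

(** The preimage of the singleton of [g w] is an invariant set containing [w], hence also [f w]; the
    equality holds everywhere. *)
Lemma measurable_wrt_invariant (g : T -> R) : measurable_wrt (invariant_sets f) g ->
  forall w, g (f w) = g w.
Proof.
move=> mg w; have [_ /seteqP[_ /(_ w erefl)]] := mg [set g w] (measurable_set1 _).
by [].
Qed.

End MeasurePreserving.

Theorem proposition3 (R : realType) (d : nat -> measure_display)
  (Omega : forall n, measurableType (d n))
  (P : forall n, probability (Omega n) R)
  (k : nat -> nat) (F : forall n, nat -> set (set (Omega n)))
  (X : forall n, nat -> {RV (P n) >-> R})
  (F_filtration : forall n, filtration (F n))
  (X_mart_diff : forall n j, (1 <= j <= k n)%N ->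
     martingale_difference (P n) (F n) (X n) j)
  (hi : cvg0_in_probability P
     (fun n w => \big[Num.max/0]_(1 <= i < (k n).+1) `|X n i w|))
  (hii : exists L : R, forall n,
     ('E_(P n)[fun w => (\big[Num.max/0]_(1 <= j < (k n).+1) X n j w ^+ 2)%R]
       <= L%:E)%E)
  (ell : nat -> nat) (eta2 : forall n, {RV (P n) >-> R})
  (hell : forall n, (1 <= ell n <= k n)%N)
  (eta2_ge0 : forall n w, 0 <= eta2 n w)
  (hiii_meas : forall n, measurable_wrt (F n (ell n)) (eta2 n))
  (hiii : cvg0_in_probability P
     (fun n w => \sum_(1 <= j < (k n).+1) X n j w ^+ 2 - eta2 n w))
  (d' : measure_display) (Omega' : measurableType d')
  (P' : probability Omega' R) (eta2_lim : {RV P' >-> R})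
  (eta2_lim_ge0 : forall w, 0 <= eta2_lim w)
  (hiv : cvg_in_distribution P eta2 (distribution P' eta2_lim))
  (hvi_or_vii :
     (forall n, measurable_wrt (F n 0%N) (eta2 n)) \/
     (forall n,
        (forall j, (1 <= j)%N -> martingale_difference (P n) (F n) (X n) j) /\
        exists T : Omega n -> Omega n,
          [/\ measure_preserving (P n) T,
              forall j, X n j = X n 0%N \o iter j T :> (Omega n -> R) &
              measurable_wrt (invariant_sets T) (eta2 n)])) :
  exists mu : probability R R,
    cvg_in_distribution P
      (fun n w => \sum_(1 <= j < (k n).+1) X n j w) mu /\
    forall t : R,
      charfun mu t = (\int[P']_w expR (- (eta2_lim w * t ^+ 2) / 2))%:C%C.
Proof.
have [L hL] := hii.
exists (gaussian_mixture eta2_lim); split; last first.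
  by move=> t; rewrite /charfun cos_gaussian_mixture// sin_gaussian_mixture.
case: hvi_or_vii => [h0|hvii].
  exact: (martingale_clt_F0 F_filtration X_mart_diff hi hL eta2_ge0 h0 hiii eta2_lim_ge0 hiv).
have shift n : exists tau : Omega n -> Omega n,
    [/\ measure_preserving (P n) tau,
        forall j w, X n (j + ell n)%N w = X n j (tau w) &
        forall w, eta2 n w = eta2 n (tau w)].
  have [_ [T [TP XT eT]]] := hvii n; exists (iter (ell n) T); split.
  - exact: (measure_preserving_iter TP (ell n)).
  - by move=> j w; rewrite XT (XT j)/= iterD.
  - move=> w; elim: (ell n) => //= m ->.
    by rewrite (measurable_wrt_invariant eT).
pose X' n j := X n (j + ell n)%N.
pose F' n j := F n (j + ell n)%N.
have F'_filtration n : filtration (F' n).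
  split=> [j|i j ij]; first exact: (F_filtration n).1.
  by apply: (F_filtration n).2; rewrite leq_add2r.
(* The shifted indices run up to [k n + ell n], past the end of the row, so the martingale property
   is taken from (vii), where it covers all [j >= 1]. *)
have X'_mart n j : (1 <= j <= k n)%N -> martingale_difference (P n) (F' n) (X' n) j.
  case: j => // j _; have [h _] := hvii n.
  by have [h1 h2 h3] := h (j.+1 + ell n)%N isT; split.
have prob_shift n (g : Omega n -> R) e tau : measurable_fun setT g ->
    measure_preserving (P n) tau ->
    P n [set w | e <= `|g (tau w)|] = P n [set w | e <= `|g w|].
  by move=> mg tauP; rewrite -(tauP.2 [set w | e <= `|g w|])//; exact: measurable_norm_ge.
(* Hypotheses (i) to (iii) transfer to the shifted array because each quantity is the original one
   composed with [tau]; in (iii) this relies on the invariance of [eta2]. *)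
have hi' : cvg0_in_probability P
    (fun n w => \big[Num.max/0]_(1 <= i < (k n).+1) `|X' n i w|).
  move=> e e0; rewrite (_ : (fun n => _) = fun n =>
      P n [set w | e <= `|\big[Num.max/0]_(1 <= i < (k n).+1) `|X n i w| |]); first exact: hi.
  apply/funext => n; have [tau [tauP Xtau _]] := shift n.
  rewrite -[RHS](prob_shift n _ e tau)//; last first.
    by apply: measurable_bigmax => j; exact: measurableT_comp.
  congr (P n _); apply: eq_set => w; congr (is_true (e <= `|_|)).
  by apply: eq_bigr => i _; rewrite /X' Xtau.
have hL' n : ('E_(P n)[fun w => (\big[Num.max/0]_(1 <= j < (k n).+1) X' n j w ^+ 2)%R]
    <= L%:E)%E.
  apply: le_trans (hL n); have [tau [tauP Xtau _]] := shift n.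
  pose g w : R := \big[Num.max/0]_(1 <= j < (k n).+1) X n j w ^+ 2.
  have mg : measurable_fun setT (EFin \o g).
    by apply/measurable_EFinP/measurable_bigmax => j; exact: measurable_funX.
  have g0 w : (0 <= (EFin \o g) w)%E by rewrite lee_fin bigmax_ge_id.
  rewrite unlock -[leRHS](measure_preserving_ge0_integral tauP mg g0).
  rewrite le_eqVlt; apply/orP; left; apply/eqP/eq_integral => w _ /=; congr EFin.
  by apply: eq_bigr => i _; rewrite /X' Xtau.
have hiii' : cvg0_in_probability P
    (fun n w => \sum_(1 <= j < (k n).+1) X' n j w ^+ 2 - eta2 n w).
  move=> e e0; rewrite (_ : (fun n => _) = fun n =>
      P n [set w | e <= `|\sum_(1 <= j < (k n).+1) X n j w ^+ 2 - eta2 n w| ]); first exact: hiii.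
  apply/funext => n; have [tau [tauP Xtau etau]] := shift n.
  rewrite -[RHS](prob_shift n _ e tau)//; last first.
    apply: measurable_funB => //; apply: measurable_sum => j.
    exact: measurable_funX.
  congr (P n _); apply: eq_set => w; rewrite -etau; congr (is_true (e <= `|_ - _|)).
  by apply: eq_bigr => i _; rewrite /X' Xtau.
have := martingale_clt_F0 F'_filtration X'_mart hi' hL' eta2_ge0 hiii_meas hiii'
  eta2_lim_ge0 hiv.
move=> h f cf bf; have [B fB] : exists B, forall x, `|f x| <= B.
  by have [B0 [_ fB0]] := bf; exists (B0 + 1) => x; apply: (fB0 (B0 + 1)) => //; rewrite ltrDl.
rewrite [X in X @ _ --> _](_ : _ = fun n =>
  \int[P n]_w f (\sum_(1 <= j < (k n).+1) X' n j w)); first exact: h.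
apply/funext => n.
have [tau [tauP Xtau _]] := shift n.
have mS : measurable_fun setT (fun w => \sum_(1 <= j < (k n).+1) X n j w).
  by apply: measurable_sum => j.
have mf : measurable_fun setT f by exact: continuous_measurable_fun.
have mfS := measurableT_comp mf mS.
rewrite -[LHS](measure_preserving_Rintegral tauP mfS (fun w => fB _)).
apply: eq_Rintegral => w _ /=; congr f.
by apply: eq_bigr => i _; rewrite -Xtau.
Qed.
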